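(* Let $\delta>0$ be fixed. Let $u_0\in L^2(\mathbb R)$ and let $u=u(x,t)$ be the global in time solution of the initial value problem for the ILW equation with $u(\cdot,0)=u_0$, such that $$u\in C(\mathbb R:L^2(\mathbb R))\cap L^\infty(\mathbb R:L^2(\mathbb R)).$$ Let $0<b<\frac23$ and, for $t>0$, let $B_{t^b}(0)=\{x\in\mathbb R: |x|<t^b\}$. Then $$\liminf_{t\to\infty}\int_{B_{t^b}(0)}u^2(x,t)\,dx=0 .$$ Moreover, there exist a constant $C>0$ and an increasing sequence of times $t_n\to\infty$ such that $$\int_{B_{t_n^b}(0)}u^2(x,t_n)\,dx\le\frac{C}{\log^{\frac{1-b}{b}}(t_n)} .$$
   Context: The Intermediate Long Wave (ILW) equation, with fixed parameter $\delta>0$, is $$\partial_t u+\mathcal T_\delta\partial_x^2u+\frac1\delta\partial_xu+u\,\partial_xu=0,\qquad (x,t)\in\mathbb R\times\mathbb R,$$ for a real-valued function $u=u(x,t)$, where $$\mathcal T_\delta f(x)=-\frac1{2\delta}\,\mathrm{p.v.}\int_{\mathbb R}\coth\Big(\frac{\pi(x-y)}{2\delta}\Big)f(y)\,dy .$$ Equivalently, with $\widehat f(\xi)=\int e^{-ix\xi}f(x)\,dx$, the operator $\mathcal T_\delta\partial_x^2+\frac1\delta\partial_x$ is the Fourier multiplier with symbol $-i\,\Omega_\delta(\xi)$, $\Omega_\delta(\xi)=\xi^2\coth(\delta\xi)-\xi/\delta$. The initial value problem is globally well posed in $H^s(\mathbb R)$ for every $s\ge0$ (Ifrim–Saut): for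 each $T>0$ the data-to-solution map on smooth ($H^\infty$) data extends uniquely to a continuous map $H^s(\mathbb R)\to C([-T,T]:H^s(\mathbb R))$; ''solution'' means the one given by this map. Solutions conserve the $L^2$-norm. *)

(* Defs.v *)
From HB Require Import structures.
From mathcomp Require Import all_boot all_order all_algebra.
From mathcomp Require Import all_classical all_reals all_analysis.
Set Implicit Arguments.
Unset Strict Implicit.
Unset Printing Implicit Defensive.
Import Order.TTheory GRing.Theory Num.Theory.
Import numFieldNormedType.Exports.
Local Open Scope classical_set_scope.
Local Open Scope ring_scope.

(* Functions of (x, t) are curried with the time first: [u t x] is u(x, t).
   Elements of L^2(R) are represented by functions R -> R, identified only
   through the seminorm [L2norm] or almost-everywhere equality. *)

Definition L2 (R : realType) (f : R -> R) : Prop :=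
  f \in Lfun (@lebesgue_measure R) 2%:E.

Definition L2norm (R : realType) (f : R -> R) : \bar R :=
  'N[@lebesgue_measure R]_2%:E[EFin \o f].

(* u \in C(R : L^2(R)) *)
Definition continuous_L2 (R : realType) (u : R -> R -> R) : Prop :=
  (forall t, L2 (u t)) /\
  (forall t, L2norm (fun x => u s x - u t x) @[s --> t] --> 0%E).

(* u \in L^oo(R : L^2(R)) *)
Definition bounded_L2 (R : realType) (u : R -> R -> R) : Prop :=
  exists M : R, {ae @lebesgue_measure R, forall t, (L2norm (u t) <= M%:E)%E}.

(* H^oo(R), the intersection of all H^s(R): the smooth functions all of whose
   derivatives are in L^2(R). *)
Definition Hinfty (R : realType) (v : R -> R) : Prop :=
  forall k, (forall x, derivable (derive1n k v) x 1) /\ L2 (derive1n k v).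

(* u \in C(R : H^oo(R)) *)
Definition continuous_Hinfty (R : realType) (u : R -> R -> R) : Prop :=
  (forall t, Hinfty (u t)) /\
  (forall k, continuous_L2 (fun t => derive1n k (u t))).

Definition coth (R : realType) (x : R) : R :=
  (expR x + expR (- x)) / (expR x - expR (- x)).

(* [is_Tdelta delta f x l] states that the principal value T_delta f (x) exists
   and equals l.  As coth does not decay, the principal value is taken at
   infinity as well as at the singularity y = x: for f in L^2(R) the
   integrand need not be integrable over |x - y| > e. *)
Definition is_Tdelta (R : realType) (delta : R) (f : R -> R) (x l : R) : Prop :=
  - (delta *+ 2)^-1 *
    (\int[@lebesgue_measure R]_(y in [set y | p.1 < `|x - y| < p.2])
       (coth (pi * (x - y) / (delta *+ 2)) * f y))%R
  @[p --> filter_prod 0^'+ +oo%R] --> l.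

Definition smooth_ilw_solution (R : realType) (delta : R) (w : R -> R -> R) :
    Prop :=
  continuous_Hinfty w /\
  forall t x, derivable (fun s => w s x) t 1 /\
    exists2 l, is_Tdelta delta (derive1n 2 (w t)) x l &
      derive1 (fun s => w s x) t + l + delta^-1 * derive1 (w t) x
        + w t x * derive1 (w t) x = 0.

(* [ilw_flow delta S]: S is the data-to-solution map of the ILW equation on
   L^2(R), i.e. it agrees with the classical solution on H^oo data and is
   continuous from L^2(R) to C([-T, T] : L^2(R)) for every T > 0.  These
   requirements determine S v t up to almost-everywhere equality for every v in
   L^2(R), and put no constraint on S v for other v. *)
Definition ilw_flow (R : realType) (delta : R) (S : (R -> R) -> R -> R -> R) :
    Prop :=
  [/\ forall v, Hinfty v ->
        exists w, [/\ smooth_ilw_solution delta w, w 0 = v &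
          forall t, S v t = w t %[ae @lebesgue_measure R]],
      forall v, L2 v -> continuous_L2 (S v) &
      forall T : R, 0 < T -> forall v, L2 v -> forall e : R, 0 < e ->
        exists2 d : R, 0 < d & forall v', L2 v' ->
          (L2norm (fun x => v' x - v x)%R < d%:E)%E ->
          forall t, - T <= t <= T ->
            (L2norm (fun x => S v' t x - S v t x)%R <= e%:E)%E].

Definition ilw_solution (R : realType) (delta : R) (u0 : R -> R)
    (u : R -> R -> R) : Prop :=
  u 0 = u0 %[ae @lebesgue_measure R] /\
  exists2 S, ilw_flow delta S &
    forall t, u t = S u0 t %[ae @lebesgue_measure R].

(* The integral of u(x, t)^2 over |x| < r *)
Definition local_mass (R : realType) (u : R -> R -> R) (r t : R) : \bar R :=
  (\int[@lebesgue_measure R]_(x in [set x | (`|x| < r)%R]) ((u t x) ^+ 2)%:E)%E.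

(* Main.v *)
Require Import Defs.
From HB Require Import structures.
From mathcomp Require Import all_boot all_order all_algebra.
From mathcomp Require Import all_classical all_reals all_analysis.
From mathcomp Require Import measurable_realfun ring lra.
Import Order.TTheory GRing.Theory Num.Theory.
Import numFieldNormedType.Exports.
Local Open Scope classical_set_scope.
Local Open Scope ring_scope.

Set Implicit Arguments.
Unset Strict Implicit.
Unset Printing Implicit Defensive.

(** The proof follows the momentum of the solution, localized by a weight
    [Phi], between times [T] and [2 T]:
    [J(t) = int u(t, x) Phi(x) dx], where [Phi(x) = S(x / lam) - S(x / L)] and
    [S] is an odd step of class C^2, constant on each side of [-1, 1].
    The slope of the weight is at least [1 / (2 lam) - 1 / L] on
    [|x| <= lam / 2] and at least [- 1 / L] elsewhere, and the weight vanishes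
    for [|x| >= L].  For a smooth solution, the equation gives
    [J' = 1/2 int u^2 Phi' - int (T_delta u_xx + u_x / delta) Phi]
    (lemma [smooth_ilw_momentum_derive]).
    The nonlinear term is at least [c / lam] times the mass in
    [|x| <= lam / 2], up to an error [M^2 / L] with [M] a bound of the L2 norm,
    whereas [|J| <= C M sqrt L] by Cauchy-Schwarz.  By the mean value theorem
    the derivative of [J] is at most [C M sqrt L / T] at some time between [T]
    and [2 T], so that the local mass is small at that time as soon as the
    dispersive term is (lemma [smooth_local_mass_le]).

    The dispersive term is handled without Fourier analysis.  On the half line
    [z > 0] one has [coth = 1 + kappa] in suitable units, with [kappa] of order
    [1 / z] at 0 and exponentially decaying.  The constant 1 integrates [u_xx]
    back to [u_x] and cancels the drift [u_x / delta] exactly; what remains is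
    [- 1 / (2 delta) int kappa(z) (u_xx(x - z) - u_xx(x + z)) dz]
    (lemma [is_Tdelta_kappa_conv]).  When it is paired with [Phi], Fubini and
    two integrations by parts move the derivatives to the weight, where the
    difference of the values of [Phi''] at distance [2 z] brings the factor [z]
    that makes [kappa] integrable.  The result is of size
    [M sqrt L / lam^3], since the third derivative of [Phi] is of size
    [1 / lam^3] (lemma [kappa_conv_pairing_le]).

    Altogether the local mass is bounded, at some time in [T, 2 T], by a
    multiple of [lam (sqrt L / T + 1 / L + sqrt L / lam^3)].  The choice
    [L ~ T^(2/3)] and [lam ~ T^b'], where [b' = max(b, 1/2) < 2/3], makes this
    a negative power of [T] (lemma [smooth_decay]), which is better than any
    power of [ln T].

    A solution in L2 is, uniformly on bounded time intervals, an L2 limit of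
    smooth solutions, because the flow is continuous and [H^oo] is dense in L2
    (lemmas [ilw_solution_smooth_approx] and [Hinfty_dense_L2]); since the
    bound for smooth solutions involves nothing but the L2 norm, it passes to
    the limit (lemma [local_mass_decay]).  Density is proved with explicit
    functions: differences of steep sigmoids approximate indicators of
    intervals, step functions approximate continuous functions, and those are
    dense. *)

(** * Integrals of continuous functions over segments *)

Section Segment.
Context {R : realType}.
Notation mu := (@lebesgue_measure R).
Implicit Types (f g F G : R -> R) (a b c : R).

Lemma continuous_itv_integrable a b f : continuous f ->
  mu.-integrable `[a, b] (EFin \o f).
Proof.
move=> cf; apply: continuous_compact_integrable; first exact: segment_compact.
exact: continuous_subspaceT.
Qed.

Lemma continuous_mul f g : continuous f -> continuous g ->
  continuous (fun x => f x * g x).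
Proof. by move=> cf cg x; apply: cvgM; [exact: cf|exact: cg]. Qed.

Lemma continuous_add f g : continuous f -> continuous g ->
  continuous (fun x => f x + g x).
Proof. by move=> cf cg x; apply: cvgD; [exact: cf|exact: cg]. Qed.

Lemma continuous_sqr f : continuous f -> continuous (fun x => f x ^+ 2).
Proof. by move=> cf; apply: continuous_mul. Qed.

Lemma continuous_norm f : continuous f -> continuous (fun x => `|f x|).
Proof. by move=> cf x; apply: (continuous_comp (cf x)); exact: norm_continuous. Qed.

Lemma is_derive_continuous F f :
  (forall x : R, is_derive x 1 F (f x)) -> continuous F.
Proof.
move=> dF x; apply/differentiable_continuous/derivable1_diffP.
by have [] := dF x.
Qed.

Lemma Rintegral_FTC a b f F : a <= b -> continuous f ->
  (forall x : R, is_derive x 1 F (f x)) ->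
  \int[mu]_(x in `[a, b]) f x = F b - F a.
Proof.
rewrite le_eqVlt => /predU1P[->|ab] cf dF.
  by rewrite set_itv1 Rintegral_set1 subrr.
have cF := is_derive_continuous dF.
rewrite /Rintegral (@continuous_FTC2 _ f F)//.
- exact: continuous_subspaceT.
- split.
  + by move=> x _; have [] := dF x.
  + exact/cvg_at_right_filter/cF.
  + exact/cvg_at_left_filter/cF.
- by move=> x _; rewrite derive1E; have [_ ->] := dF x.
Qed.

Lemma Rintegral_by_parts a b F f G g : a <= b ->
  continuous f -> continuous g ->
  (forall x : R, is_derive x 1 F (f x)) -> (forall x : R, is_derive x 1 G (g x)) ->
  \int[mu]_(x in `[a, b]) (F x * g x) =
  F b * G b - F a * G a - \int[mu]_(x in `[a, b]) (f x * G x).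
Proof.
move=> ab cf cg dF dG.
have cF := is_derive_continuous dF.
have cG := is_derive_continuous dG.
have c1 := continuous_mul cF cg; have c2 := continuous_mul cf cG.
have <- : \int[mu]_(x in `[a, b]) (F x * g x + f x * G x) = F b * G b - F a * G a.
  apply: (@Rintegral_FTC a b _ (fun x => F x * G x)) => //.
    exact: continuous_add.
  move=> x; apply: is_derive_eq.
  by rewrite /GRing.scale/= [G x * _]mulrC.
by rewrite RintegralD ?addrK//; exact: continuous_itv_integrable.
Qed.

Lemma Rintegral_shift a b c f : a <= b -> continuous f ->
  \int[mu]_(x in `[a, b]) f (x + c) = \int[mu]_(x in `[a + c, b + c]) f x.
Proof.
move=> ab cf; rewrite /Rintegral; congr fine.
have dF (x : R) : is_derive x 1 (fun y : R => y + c) 1.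
  by apply: is_derive_eq; rewrite addr0.
have dE : derive1 (fun y : R => y + c) = cst 1.
  by apply/funext => x; rewrite derive1E; have [_ ->] := dF x.
rewrite (@integration_by_substitution_increasing _ (fun y => y + c))//.
- by apply: eq_integral => x _; rewrite dE /= fctE mulr1.
- by move=> x y _ _ ; rewrite ltrD2r.
- by rewrite dE => x _; exact: cst_continuous.
- by rewrite dE; exact: is_cvg_cst.
- by rewrite dE; exact: is_cvg_cst.
- have cF : continuous (fun y : R => y + c).
    by move=> x; apply: continuousD => //; exact: cst_continuous.
  split.
  + by move=> x _; have [] := dF x.
  + exact/cvg_at_right_filter/cF.
  + exact/cvg_at_left_filter/cF.
- exact: continuous_subspaceT.
Qed.

Lemma Rintegral_reflect a b c f : a <= b -> continuous f ->
  \int[mu]_(x in `[a, b]) f (c - x) = \int[mu]_(x in `[c - b, c - a]) f x.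
Proof.
move=> ab cf; rewrite /Rintegral; congr fine.
have cfc : continuous (fun x => f (x + c)).
  move=> x; apply: (@continuous_comp _ _ _ (fun x => x + c) f); last exact: cf.
  by apply: continuousD => //; exact: cst_continuous.
have := @Rintegral_shift (- b) (- a) c f.
rewrite lerN2 => /(_ ab cf).
have E : (\int[mu]_(x in `[(- b)%R, (- a)%R]) (f (x + c)%R)%:E =
  \int[mu]_(x in `[a, b]) (f (c - x)%R)%:E)%E.
  rewrite (integration_by_substitution_oppr ab); last exact: continuous_subspaceT.
  by apply: eq_integral => x _ /=; rewrite addrC.
have i1 : mu.-integrable `[- b, - a] (EFin \o (fun x => f (x + c))).
  exact: continuous_itv_integrable.
have i2 : mu.-integrable `[- b + c, - a + c] (EFin \o f).
  exact: continuous_itv_integrable.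
move=> H; have {H} := congr1 (@EFin R) H; rewrite /Rintegral !fineK; last 2 first.
- exact: integrable_fin_num i2.
- exact: integrable_fin_num i1.
by rewrite E => ->; rewrite ![_ + c]addrC.
Qed.

Lemma le_Rintegral_itv a b f g : continuous f -> continuous g ->
  (forall x, a <= x <= b -> f x <= g x) ->
  \int[mu]_(x in `[a, b]) f x <= \int[mu]_(x in `[a, b]) g x.
Proof.
move=> cf cg fg; apply: le_Rintegral; [by []|exact: continuous_itv_integrable..|].
by move=> x /=; rewrite in_itv/=; exact: fg.
Qed.

Lemma normr_Rintegral_itv a b f : continuous f ->
  `|\int[mu]_(x in `[a, b]) f x| <= \int[mu]_(x in `[a, b]) `|f x|.
Proof. by move=> cf; apply: le_normr_Rintegral => //; exact: continuous_itv_integrable. Qed.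

Lemma Rintegral_itv_cst a b c : a <= b -> \int[mu]_(x in `[a, b]) c = c * (b - a).
Proof.
move=> ab; rewrite Rintegral_cst//= lebesgue_measure_itv/= lte_fin.
move: ab; rewrite le_eqVlt => /predU1P[->|ab]; last by rewrite ab.
by rewrite ltxx subrr.
Qed.

Lemma le_Rintegral_itv_subset a b c d f : continuous f -> (forall x, 0 <= f x) ->
  a <= c -> d <= b ->
  \int[mu]_(x in `[c, d]) f x <= \int[mu]_(x in `[a, b]) f x.
Proof.
move=> cf f0 ac db; have i1 := @continuous_itv_integrable a b f cf.
have i2 := @continuous_itv_integrable c d f cf.
rewrite -lee_fin /Rintegral !fineK; last 2 first.
- exact: integrable_fin_num i1.
- exact: integrable_fin_num i2.
apply: ge0_subset_integral => //.
- exact: measurable_int i1.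
- by move=> x _; rewrite lee_fin.
- by apply: subset_itv; rewrite bnd_simp.
Qed.

Lemma continuous_comp_sub f c : continuous f -> continuous (fun x => f (c - x)).
Proof.
move=> cf x; apply: (@continuous_comp _ _ _ (fun x => c - x) f); last exact: cf.
by apply: cvgD; [exact: cst_continuous|exact: continuousN].
Qed.

Lemma continuous_comp_add f c : continuous f -> continuous (fun x => f (x + c)).
Proof.
move=> cf x; apply: (@continuous_comp _ _ _ (fun x => x + c) f); last exact: cf.
by apply: cvgD => //; exact: cst_continuous.
Qed.

Lemma continuous_sym_diff f c : continuous f ->
  continuous (fun x => f (c - x) - f (c + x)).
Proof.
move=> cf; have cp : continuous (fun x => f (c + x)).
  by under [X in continuous X]eq_fun do rewrite addrC; exact: continuous_comp_add.
by move=> x; apply: cvgB; [exact: continuous_comp_sub|exact: cp].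
Qed.

Lemma is_derive_comp_sub F f c (x : R) : (forall x : R, is_derive x 1 F (f x)) ->
  is_derive x 1 (fun z => F (c - z)) (- f (c - x)).
Proof.
move=> dF; have dg : is_derive x 1 (fun z => c - z) (- 1).
  by apply: is_derive_eq; rewrite add0r mul1r.
have := @is_derive1_comp _ F (fun z => c - z) x _ _ (dF (c - x)) dg.
by rewrite mulrN1.
Qed.

Lemma is_derive_comp_add F f c (x : R) : (forall x : R, is_derive x 1 F (f x)) ->
  is_derive x 1 (fun z => F (c + z)) (f (c + x)).
Proof.
move=> dF; have dg : is_derive x 1 (fun z => c + z) 1.
  by apply: is_derive_eq; rewrite ?add0r ?mul1r ?mulr1.
have := @is_derive1_comp _ F (fun z => c + z) x _ _ (dF (c + x)) dg.
by rewrite mulr1.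
Qed.

End Segment.

(** * The L2 norm *)

Section L2norm.
Context {R : realType}.
Notation mu := (@lebesgue_measure R).
Implicit Types (f g h : R -> R).
Local Open Scope ereal_scope.

Lemma near_lt_of_cvg0 (I : Type) (F : set_system I) {FF : Filter F}
    (v : I -> \bar R) (e : R) : v x @[x --> F] --> 0 -> (0 < e)%R ->
  \forall x \near F, v x < e%:E.
Proof.
move=> /fine_cvgP[fv] /cvgr0_norm_lt H e0; have {}H := H e e0.
apply: filterS2 fv H => x fx lt.
by rewrite -(fineK fx) lte_fin; apply: le_lt_trans lt; exact: ler_norm.
Qed.

Lemma L2_measurable f : L2 f -> measurable_fun setT f.
Proof. by rewrite /L2 inE => /andP[/[!inE]]. Qed.

Lemma L2_lty f : L2 f -> L2norm f < +oo.
Proof. by rewrite /L2 inE => /andP[_ /[!inE]]. Qed.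

Lemma L2P f : measurable_fun setT f -> L2norm f < +oo -> L2 f.
Proof. by move=> mf nf; rewrite /L2 inE; apply/andP; split; rewrite inE. Qed.

Lemma L2norm_ge0 f : 0 <= L2norm f.
Proof. exact: Lnorm_ge0. Qed.

Lemma L2norm_sqr f : L2norm f `^ 2 = \int[mu]_x ((f x) ^+ 2)%:E.
Proof.
rewrite /L2norm poweR_Lnorm//; apply: eq_integral => x _ /=.
by rewrite powR_mulrn// real_normK// num_real.
Qed.

Lemma L2norm_leP f (M : R) : (0 <= M)%R ->
  (L2norm f <= M%:E) <-> \int[mu]_x ((f x) ^+ 2)%:E <= (M ^+ 2)%:E.
Proof.
move=> M0; rewrite -L2norm_sqr.
have -> : (M ^+ 2)%:E = M%:E `^ 2 by rewrite poweR_EFin powR_mulrn.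
split => [|h].
  by apply: gt0_ler_poweR => //; rewrite in_itv/= leey ?L2norm_ge0 ?lee_fin ?M0.
have -> : L2norm f = (L2norm f `^ 2) `^ 2^-1.
  by rewrite -poweRrM mulfV// poweRe1// L2norm_ge0.
have -> : M%:E = (M%:E `^ 2) `^ 2^-1.
  by rewrite -poweRrM mulfV// poweRe1// lee_fin.
apply: gt0_ler_poweR; rewrite ?invr_ge0// ?in_itv/= ?leey ?poweR_ge0//.
by rewrite andbT lee_fin powR_ge0.
Qed.

Lemma L2norm_triangle f g : measurable_fun setT f -> measurable_fun setT g ->
  L2norm (fun x => f x + g x)%R <= L2norm f + L2norm g.
Proof. by move=> mf mg; apply: minkowski_EFin => //; rewrite ler1n. Qed.

Lemma L2normN f : L2norm (fun x => - f x)%R = L2norm f.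
Proof.
rewrite /L2norm -[RHS]oppe_Lnorm; congr Lnorm.
Qed.

Lemma L2normBC f g : L2norm (fun x => f x - g x)%R = L2norm (fun x => g x - f x)%R.
Proof.
by rewrite -L2normN; congr L2norm; apply/funext => x; rewrite opprB.
Qed.

Lemma L2norm_triangleB f g h : measurable_fun setT f -> measurable_fun setT g ->
  measurable_fun setT h ->
  L2norm (fun x => f x - h x)%R <=
  L2norm (fun x => f x - g x)%R + L2norm (fun x => g x - h x)%R.
Proof.
move=> mf mg mh.
have -> : (fun x => f x - h x)%R = (fun x => (f x - g x) + (g x - h x))%R.
  by apply/funext => x; rewrite addrA subrK.
by apply: L2norm_triangle; exact: measurable_funB.
Qed.

Lemma L2norm_le_dist f g : measurable_fun setT f -> measurable_fun setT g ->
  L2norm f <= L2norm (fun x => f x - g x)%R + L2norm g.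
Proof.
move=> mf mg.
have {1}-> : f = (fun x => (f x - g x) + g x)%R.
  by apply/funext => x; rewrite subrK.
by apply: L2norm_triangle => //; exact: measurable_funB.
Qed.

Lemma ae_eq_L2norm f g : measurable_fun setT f -> measurable_fun setT g ->
  f = g %[ae mu] -> L2norm f = L2norm g.
Proof.
move=> mf mg fg; rewrite /L2norm unlock; congr (_ `^ _).
apply: ae_eq_integral => //.
- by apply: (measurableT_comp (measurable_poweR _)); apply: measurableT_comp => //;
  exact/measurable_EFinP.
- by apply: (measurableT_comp (measurable_poweR _)); apply: measurableT_comp => //;
  exact/measurable_EFinP.
- exact: (ae_eq_comp (fun r : R => `|r%:E| `^ 2) fg).
Qed.

End L2norm.

(** * Local estimates from the L2 norm *)

Section L2norm_segment.
Context {R : realType}.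
Notation mu := (@lebesgue_measure R).
Implicit Types (f g v : R -> R).

Lemma L2norm_itv_sqr a b f M : continuous f -> 0 <= M ->
  (L2norm f <= M%:E)%E ->
  \int[mu]_(x in `[a, b]) (f x ^+ 2) <= M ^+ 2.
Proof.
move=> cf M0 /(L2norm_leP _ M0) h.
have cf2 := continuous_sqr cf.
have i2 := @continuous_itv_integrable R a b _ cf2.
rewrite -lee_fin /Rintegral fineK; last exact: integrable_fin_num i2.
apply: le_trans h; apply: ge0_subset_integral => //.
- apply/measurable_EFinP; exact: continuous_measurable_fun.
- by move=> x _; rewrite lee_fin sqr_ge0.
Qed.

(** Cauchy-Schwarz against the indicator of a segment, obtained by optimizing
    the weight in [2 |f| <= theta f^2 + 1 / theta]. *)
Lemma Rintegral_norm_le_L2norm a b f M : continuous f -> a < b -> 0 < M ->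
  (L2norm f <= M%:E)%E ->
  \int[mu]_(x in `[a, b]) `|f x| <= M * Num.sqrt (b - a).
Proof.
move=> cf ab M0 h.
set s := Num.sqrt (b - a).
have s0 : 0 < s by rewrite sqrtr_gt0 subr_gt0.
have s2 : s ^+ 2 = b - a by rewrite sqr_sqrtr// subr_ge0 ltW.
have cnf := continuous_norm cf.
have cf2 := continuous_sqr cf.
have cf3 : continuous (fun x => s / M / 2 * f x ^+ 2).
  by apply: continuous_mul => // x; exact: cst_continuous.
have cc : continuous (fun x : R => M / s / 2) by move=> x; exact: cst_continuous.
apply: (@le_trans _ _ (\int[mu]_(x in `[a, b]) (s / M / 2 * f x ^+ 2 + M / s / 2))).
  apply: le_Rintegral_itv => //.
    exact: continuous_add.
  move=> x _; rewrite -real_normK ?num_real//.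
  have -> : s / M / 2 * `|f x| ^+ 2 + M / s / 2 =
    `|f x| + (s / M / 2) * (`|f x| - M / s) ^+ 2.
    by field; rewrite !gt_eqF.
  by rewrite lerDl mulr_ge0 ?sqr_ge0// !divr_ge0// ltW.
rewrite RintegralD//; [|exact: continuous_itv_integrable..].
rewrite RintegralZl//; last exact: continuous_itv_integrable.
rewrite (Rintegral_itv_cst _ (ltW ab)) -s2.
have := @L2norm_itv_sqr a b f M cf (ltW M0) h => h2.
apply: (@le_trans _ _ (s / M / 2 * M ^+ 2 + M / s / 2 * s ^+ 2)).
  by rewrite lerD2r ler_wpM2l// !divr_ge0// ltW.
by rewrite le_eqVlt; apply/orP; left; apply/eqP; field; rewrite !gt_eqF.
Qed.

(** [v x] differs from each value of [v] on the window by at most the integral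
    of [|v']|; averaging over a window of unit length gives the bound. The bound
    tends to 0 at infinity when [v] and [v'] are in L2. *)
Lemma le_norm_itv_avg (x : R) v v' : continuous v' ->
  (forall x : R, is_derive x 1 v (v' x)) ->
  `|v x| <= \int[mu]_(y in `[x, x + 1]) `|v y| + \int[mu]_(y in `[x, x + 1]) `|v' y|.
Proof.
move=> cv' dv; have cv := is_derive_continuous dv.
have cnv := continuous_norm cv; have cnv' := continuous_norm cv'.
have x1 : x <= x + 1 by rewrite lerDl.
set A := \int[mu]_(y in _) `|v' y|.
have key y : x <= y <= x + 1 -> `|v x| - A <= `|v y|.
  move=> /andP[xy y1].
  have vE : v x = v y - \int[mu]_(z in `[x, y]) v' z.
    by rewrite (Rintegral_FTC xy cv' dv); ring.
  have : `|\int[mu]_(z in `[x, y]) v' z| <= A.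
    by apply: le_trans (normr_Rintegral_itv _ _ cv') _; exact: le_Rintegral_itv_subset.
  have := ler_normB (v y) (\int[mu]_(z in `[x, y]) v' z); rewrite -vE; lra.
have : \int[mu]_(y in `[x, x + 1]) (`|v x| - A) <= \int[mu]_(y in `[x, x + 1]) `|v y|.
  by apply: le_Rintegral_itv => // z; exact: cst_continuous.
by rewrite Rintegral_itv_cst//; lra.
Qed.

(** One-dimensional Sobolev embedding. *)
Lemma sup_le_L2norm (x : R) v v' M M' : continuous v' ->
  (forall x : R, is_derive x 1 v (v' x)) -> 0 < M -> 0 < M' ->
  (L2norm v <= M%:E)%E -> (L2norm v' <= M'%:E)%E -> `|v x| <= M + M'.
Proof.
move=> cv' dv M0 M'0 h h'; have cv := is_derive_continuous dv.
apply: le_trans (le_norm_itv_avg x cv' dv) _.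
have x1 : x < x + 1 by rewrite ltrDl.
have := Rintegral_norm_le_L2norm cv x1 M0 h.
have := Rintegral_norm_le_L2norm cv' x1 M'0 h'.
have -> : x + 1 - x = 1 by ring.
by rewrite sqrtr1; lra.
Qed.

End L2norm_segment.

(** * The kernel coth - 1 *)

Section Kernel.
Context {R : realType}.
Notation mu := (@lebesgue_measure R).
Implicit Types (delta z : R).

(** The difference between coth, at the scale of [T_delta], and its limit at
    [+oo]. The value 0 for [z <= 0] turns integrals over the half line into
    integrals over the whole line. *)
Definition kappa delta z : R :=
  if 0 < z then coth (pi * z / (delta *+ 2)) - 1 else 0.

Lemma expR_gt_exprN (a : R) : 0 < a -> 0 < expR a - expR (- a).
Proof. by move=> a0; rewrite subr_gt0 ltr_expR; lra. Qed.

Lemma expR2_sub1_gt0 (a : R) : 0 < a -> 0 < expR a ^+ 2 - 1.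
Proof. by move=> a0; rewrite subr_gt0 exprn_egt1// expR_gt1. Qed.

Lemma coth_sub1E (a : R) : 0 < a -> coth a - 1 = 2 / (expR a ^+ 2 - 1).
Proof.
move=> a0; have h := expR_gt_exprN a0; rewrite /coth.
have e0 := expR_gt0 a.
have h2 := expR2_sub1_gt0 a0.
rewrite expRN in h *; field; rewrite !gt_eqF//= ?gt_eqF//.
Qed.

Lemma cothN (a : R) : coth (- a) = - coth a.
Proof. by rewrite /coth opprK addrC -mulrN -invrN opprB. Qed.

Lemma kappa_ge0 delta z : 0 < delta -> 0 <= kappa delta z.
Proof.
move=> d0; rewrite /kappa; case: ifPn => // z0.
have a0 : 0 < pi * z / (delta *+ 2) by rewrite divr_gt0 ?mulr_gt0 ?pi_gt0 ?mulrn_wgt0.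
by rewrite coth_sub1E// divr_ge0// ltW// expR2_sub1_gt0.
Qed.

Lemma kappa_le0 delta z : z <= 0 -> kappa delta z = 0.
Proof. by move=> z0; rewrite /kappa ltNge z0. Qed.

Lemma kappa_weight_ge0 delta z : 0 < delta -> 0 <= kappa delta z * (z * (1 + z)).
Proof.
move=> d0; have [z0|/kappa_le0 ->] := ltP 0 z; last by rewrite mul0r.
by rewrite mulr_ge0 ?kappa_ge0// mulr_ge0 ?addr_ge0// ltW.
Qed.

(** [coth a - 1 <= 2 / (a e^a)]: the factor [a] absorbs the singularity at 0,
    and [1 + a / 2 <= e^(a / 2)] spends half of the exponential. *)
Lemma coth_sub1_le (a : R) : 0 < a ->
  (coth a - 1) * (a * (1 + a / 2)) <= 2 * expR (- (a / 2)).
Proof.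
move=> a0; rewrite coth_sub1E// expRN.
have h1 : 1 + a / 2 <= expR (a / 2) by exact: expR_ge1Dx.
have h2 : 1 + a <= expR a by exact: expR_ge1Dx.
have h3 : expR a = expR (a / 2) ^+ 2 by rewrite -expRM_natl; congr expR; field.
set e := expR (a / 2) in h1 h3 *.
have e1 : 1 < e by rewrite expR_gt1; lra.
have d0 := expR2_sub1_gt0 a0.
rewrite mulrAC ler_pdivrMr// mulrAC ler_pdivlMr; last lra.
have : a * (1 + a / 2) * e <= expR a ^+ 2 - 1; last nra.
have : a * e ^+ 2 <= expR a ^+ 2 - 1 by rewrite -h3; nra.
have : a * ((1 + a / 2) * e) <= a * e ^+ 2; last lra.
by rewrite ler_pM2l// expr2 ler_pM2r; lra.
Qed.

(** The factor [z] absorbs the singularity of [kappa], and [1 + z] is the growth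
    of the integrals against which [kappa] is paired later on. *)
Lemma kappa_le delta : 0 < delta -> exists C r : R, [/\ 0 < C, 0 < r &
  forall z, kappa delta z * (z * (1 + z)) <= C * exponential_pdf r z].
Proof.
move=> d0; pose c : R := pi / (delta *+ 2).
have c0 : 0 < c by rewrite divr_gt0 ?pi_gt0 ?mulrn_wgt0.
have r0 : 0 < c / 2 by rewrite divr_gt0.
exists (2 * (1 + 2 / c) / c / (c / 2)), (c / 2).
have K0 : 0 < 1 + 2 / c by rewrite addr_gt0// divr_gt0.
have C0 : 0 < 2 * (1 + 2 / c) / c / (c / 2) by do 2 apply: divr_gt0 => //; exact: mulr_gt0.
split=> //.
move=> z; rewrite /kappa; case: ifPn => z0; last first.
  by rewrite mul0r mulr_ge0 ?exponential_pdf_ge0 ?ltW.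
rewrite (exponential_pdfE _ (ltW z0)).
have -> : pi * z / (delta *+ 2) = c * z by rewrite /c mulrAC.
have a0 : 0 < c * z by rewrite mulr_gt0.
have := coth_sub1_le a0.
set k := coth _ - 1.
have k0 : 0 <= k.
  by rewrite /k coth_sub1E// divr_ge0// ltW// expR2_sub1_gt0.
have -> : - (c * z / 2) = - (c / 2) * z by field.
set E := expR _ => h.
have -> : 2 * (1 + 2 / c) / c / (c / 2) * (c / 2 * E) =
   (1 + 2 / c) / c * (2 * E).
  by field; rewrite gt_eqF.
apply: le_trans (ler_wpM2l _ h); last by rewrite divr_ge0// ltW.
have -> : (1 + 2 / c) / c * (k * (c * z * (1 + c * z / 2))) =
  k * (z * ((1 + 2 / c) * (1 + c * z / 2))) by field; rewrite gt_eqF.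
have -> : (1 + 2 / c) * (1 + c * z / 2) = 1 + z + 2 / c + c * z / 2.
  by field; rewrite gt_eqF.
have p1 : 0 < 2 / c by rewrite divr_gt0.
apply: ler_wpM2l => //; apply: ler_wpM2l; first exact: ltW.
by clear -p1 a0; lra.
Qed.

Lemma measurable_kappa delta : 0 < delta -> measurable_fun setT (kappa delta).
Proof.
move=> d0.
pose g z : R := 2 * (expR (pi * z / (delta *+ 2)) ^+ 2 - 1) `^ (- 1).
rewrite (_ : kappa delta = fun z => if 0 < z then g z else 0); last first.
  apply/funext => z; rewrite /kappa /g; case: ifPn => // z0.
  have a0 : 0 < pi * z / (delta *+ 2).
    by rewrite divr_gt0 ?mulr_gt0 ?pi_gt0 ?mulrn_wgt0.
  by rewrite coth_sub1E// powR_inv1// ltW// expR2_sub1_gt0.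
apply: measurable_fun_ifT => //=.
  exact: measurable_fun_ltr.
have ml : measurable_fun setT (fun z : R => pi * z / (delta *+ 2)).
  by apply: measurable_funM => //; exact: measurable_funM.
apply: measurable_funM => //; apply: (measurableT_comp (measurable_powR _)).
apply: measurable_funB => //; apply: measurable_funX.
by apply: (measurableT_comp (@measurable_expR R)).
Qed.

(** [kappa z ~ 1 / z] at the origin and [kappa] decays exponentially. *)
Lemma integrable_kappa delta : 0 < delta ->
  mu.-integrable setT (EFin \o (fun z => kappa delta z * (z * (1 + z)))).
Proof.
move=> d0; have [C [r [C0 r0 h]]] := kappa_le d0.
have iC := integrableZl measurableT C (integrable_exponential_pdf r0).
apply: (le_integrable measurableT _ _ iC).
- apply/measurable_EFinP; apply: measurable_funM; first exact: measurable_kappa.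
  by apply: measurable_funM => //; exact: measurable_funD.
- move=> z _; rewrite lee_fin ger0_norm ?kappa_weight_ge0//.
  by apply: le_trans (h z) _; exact: ler_norm.
Qed.

End Kernel.

(** * Decay of H^1 functions at infinity *)

Section H1Decay.
Context {R : realType}.
Notation mu := (@lebesgue_measure R).
Implicit Types (v : R -> R) (y : nat -> R).

(** Dominated convergence: each point leaves the moving window eventually. *)
Lemma L2_window_cvg0 v y : L2 v -> `|y n| @[n --> \oo] --> +oo ->
  \int[mu]_(x in `[y n, y n + 1]) (v x ^+ 2) @[n --> \oo] --> (0 : R).
Proof.
move=> Lv yoo.
pose g := EFin \o (fun x => v x ^+ 2).
have ig : mu.-integrable setT g by exact: Lfun2_integrable_sqr.
have mg : measurable_fun setT g by exact: measurable_int ig.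
have H : (\int[mu]_x (g \_ `[y n, (y n + 1)%R]) x @[n --> \oo] --> \int[mu]_x cst 0 x)%E.
  apply: (@dominated_cvg _ _ _ mu _ measurableT _ (cst 0%E) g) => //.
  - by move=> n; apply/(measurable_restrictT _ _).1 => //; exact: measurable_funTS.
  - move=> x _; apply: cvg_near_cst.
    have /cvgryPgt/(_ (`|x| + 1)) := yoo.
    apply: filterS => n; rewrite patchE; case: ifPn => //.
    rewrite inE/= in_itv/= => /andP[h1 h2] h.
    suff : `|y n| <= `|x| + 1 by rewrite leNgt h.
    have := ler_norm x; have := ler_norm (- x); rewrite normrN ler_norml; lra.
  - move=> n x _; rewrite patchE; case: ifPn => _; last by rewrite abse0 lee_fin sqr_ge0.
    by rewrite gee0_abs// lee_fin sqr_ge0.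
rewrite integral0 in H.
rewrite (_ : (fun n => _) = fun n => fine (\int[mu]_x (g \_ `[y n, (y n + 1)%R]) x)%E).
  exact: fine_cvg H.
by apply/funext => n; rewrite /Rintegral [in LHS]integral_mkcond.
Qed.

(** The variance of [|v|] over a segment of length 1 is nonnegative. *)
Lemma Rintegral_norm_sqr_le (a : R) v : continuous v ->
  (\int[mu]_(x in `[a, a + 1]) `|v x|) ^+ 2 <= \int[mu]_(x in `[a, a + 1]) (v x ^+ 2).
Proof.
move=> cv; have cn := continuous_norm cv; have c2 := continuous_sqr cv.
set I := \int[mu]_(x in _) `|v x|.
have cst_c (c : R) : continuous (fun _ : R => c) by move=> z; exact: cst_continuous.
have a1 : a <= a + 1 by rewrite lerDl.
have : \int[mu]_(x in `[a, a + 1]) (2 * I * `|v x|) <=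
       \int[mu]_(x in `[a, a + 1]) (v x ^+ 2 + I ^+ 2).
  apply: le_Rintegral_itv.
  - exact: continuous_mul.
  - exact: continuous_add.
  - by move=> x _; rewrite -[v x ^+ 2]real_normK ?num_real//; have := sqr_ge0 (`|v x| - I); nra.
rewrite RintegralZl//; last exact: continuous_itv_integrable.
rewrite RintegralD//; [|exact: continuous_itv_integrable..].
rewrite Rintegral_itv_cst// -/I; nra.
Qed.

(** A value of [v] is controlled by the averages of [|v|] and [|v']| over a
    window of unit length, and these vanish at infinity because [v] and [v'] are
    in L2. *)
Lemma H1_cvg0 v v' y : continuous v' -> (forall x : R, is_derive x 1 v (v' x)) ->
  L2 v -> L2 v' -> `|y n| @[n --> \oo] --> +oo -> v (y n) @[n --> \oo] --> (0 : R).
Proof.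
move=> cv' dv Lv Lv' yoo; have cv := is_derive_continuous dv.
have avg f : continuous f -> L2 f ->
    \int[mu]_(x in `[y n, y n + 1]) `|f x| @[n --> \oo] --> (0 : R).
  move=> cf Lf; apply/cvgr0Pnorm_le => e e0.
  have e2 : 0 < e ^+ 2 by rewrite exprn_gt0.
  have /cvgr0Pnorm_le/(_ _ e2) := L2_window_cvg0 Lf yoo.
  apply: filterS => n; have := Rintegral_norm_sqr_le (y n) cf.
  set I := \int[mu]_(x in _) `|f x|; set S := \int[mu]_(x in _) (f x ^+ 2).
  move=> IS nS; rewrite -ler_sqr ?nnegrE ?(ltW e0)// real_normK ?num_real//.
  by apply: le_trans IS _; apply: le_trans nS; exact: ler_norm.
apply/cvgr0Pnorm_le => e e0.
have /cvgr0Pnorm_le/(_ _ e0) : \int[mu]_(x in `[y n, y n + 1]) `|v x| +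
    \int[mu]_(x in `[y n, y n + 1]) `|v' x| @[n --> \oo] --> (0 : R).
  by rewrite -[X in _ --> X]addr0; apply: cvgD; exact: avg.
apply: filterS => n h; apply: le_trans h; apply: le_trans (ler_norm _).
exact: le_norm_itv_avg.
Qed.

End H1Decay.

(** * The dispersive operator as a convolution *)

Section FoldedKernel.
Context {R : realType}.
Notation mu := (@lebesgue_measure R).
Implicit Types (f v : R -> R) (delta x : R).

(** The dispersive operator of the equation sends [v] to a constant multiple of
    this operator applied to [v'']: removing from coth its limit at infinity
    amounts to removing the drift term. The symmetric difference makes the
    integral absolutely convergent at [z = 0] for Lipschitz [f]. *)
Definition kappa_conv delta f x : R :=
  \int[mu]_z (kappa delta z * (f (x - z) - f (x + z))).

Lemma continuous_maxr eps : continuous (fun z : R => Num.max eps z).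
Proof.
by move=> z; apply: (@continuous_max _ _ (cst eps) id); [exact: cst_continuous|].
Qed.

Lemma continuous_compose (g f : R -> R) : continuous f -> continuous g ->
  continuous (fun x => g (f x)).
Proof. by move=> cf cg x; apply: (continuous_comp (cf x)); exact: cg. Qed.

Lemma continuous_div (f g : R -> R) : continuous f -> continuous g ->
  (forall x, g x != 0) -> continuous (fun x => f x / g x).
Proof.
move=> cf cg g0 x; apply: cvgM; first exact: cf.
by apply: cvgV; [exact: g0|exact: cg].
Qed.

(** Freezing coth below [eps] gives a function that is continuous everywhere and
    agrees with coth on the domain of the truncated principal value. *)
Lemma continuous_coth_max c eps : 0 < c -> 0 < eps ->
  continuous (fun z : R => coth (c * Num.max eps z)).
Proof.
move=> c0 e0; rewrite /coth.
have cm : continuous (fun z => c * Num.max eps z).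
  by apply: continuous_mul; [move=> z; exact: cst_continuous|exact: continuous_maxr].
have cN : continuous (fun z => - (c * Num.max eps z)).
  by move=> z; apply: cvgN; exact: cm.
have c1 := continuous_compose cm (@continuous_expR R).
have c2 := continuous_compose cN (@continuous_expR R).
apply: continuous_div.
- exact: continuous_add.
- by move=> z; apply: cvgB; [exact: c1|exact: c2].
- by move=> z; rewrite gt_eqF// expR_gt_exprN// mulr_gt0// lt_max e0.
Qed.

(** The truncated principal value folds onto [z = |x - y|] because coth is
    odd. *)
Lemma Rintegral_annulus delta f x eps N : 0 < delta -> continuous f ->
  0 < eps -> eps < N ->
  \int[mu]_(y in [set y | eps < `|x - y| < N])
    (coth (pi * (x - y) / (delta *+ 2)) * f y) =
  \int[mu]_(z in `[eps, N])
    (coth (pi / (delta *+ 2) * Num.max eps z) * (f (x - z) - f (x + z))).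
Proof.
move=> d0 cf e0 eN.
set c := pi / (delta *+ 2).
have c0 : 0 < c by rewrite divr_gt0 ?pi_gt0 ?mulrn_wgt0.
pose h z : R := coth (c * Num.max eps z).
have ch : continuous h by exact: continuous_coth_max.
(* a continuous odd function that agrees with coth (c z) for |z| >= eps *)
pose k z : R := z / Num.max eps `|z| * h `|z|.
have cn : continuous (fun z : R => `|z|) by exact: norm_continuous.
have ck : continuous k.
  apply: continuous_mul.
    apply: (@continuous_div id (fun z => Num.max eps `|z|)).
    - by move=> z; exact: cvg_id.
    - exact: (continuous_compose cn (@continuous_maxr eps)).
    - by move=> z; rewrite gt_eqF// lt_max e0.
  exact: (continuous_compose cn ch).
have kpos z : eps <= z -> k z = h z.
  move=> ez; rewrite /k ger0_norm ?(le_trans (ltW e0))// (max_idPr ez) divff ?mul1r//.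
  by rewrite gt_eqF// (lt_le_trans e0).
have kneg z : eps <= z -> k (- z) = - h z.
  move=> ez; rewrite -kpos// /k normrN; lra.
have hE z : eps <= z -> h z = coth (c * z) by move=> ez; rewrite /h (max_idPr ez).
pose g y := k (x - y) * f y.
have cg : continuous g by apply: continuous_mul => //; exact: continuous_comp_sub.
have SE : [set y | eps < `|x - y| < N] = `]x - N, x - eps[ `|` `]x + eps, x + N[.
  apply/seteqP; split => y /=; rewrite !in_itv/=.
    have [yx|yx] := leP y x.
      by rewrite ger0_norm ?subr_ge0// => H; left; lra.
    by rewrite ltr0_norm ?subr_lt0// => H; right; lra.
  case=> H.
    by rewrite ger0_norm ?subr_ge0; lra.
  by rewrite ltr0_norm ?subr_lt0; lra.
rewrite SE.
transitivity (\int[mu]_(y in `]x - N, x - eps[ `|` `]x + eps, x + N[) g y).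
  apply: eq_Rintegral => y; rewrite inE/= !in_itv/= => H; rewrite /g; congr (_ * _).
  rewrite mulrAC -/c; case: H => H.
    by rewrite kpos ?hE; lra.
  have -> : x - y = - (y - x) by ring.
  rewrite mulrN cothN kneg ?hE; lra.
have ig a b : mu.-integrable `[a, b] (EFin \o g) by exact: continuous_itv_integrable.
have igo a b : mu.-integrable `]a, b[ (EFin \o g).
  by apply: integrableS (ig a b) => //; exact: subset_itv_oo_cc.
have oc a b : \int[mu]_(y in `]a, b[) g y = \int[mu]_(y in `[a, b]) g y.
  rewrite /Rintegral (@integral_itv_bndoo _ _ _ (EFin \o g) true false)//.
  exact: (measurable_int mu (igo a b)).
rewrite Rintegral_setU//; last 2 first.
- apply: integrableS (ig (x - N) (x + N)) => //; first exact: measurableU.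
  by move=> y /=; rewrite !in_itv/=; lra.
- by apply/disj_setPS => y /= [] ; rewrite !in_itv/=; lra.
rewrite !oc.
have -> : \int[mu]_(y in `[x - N, x - eps]) g y = \int[mu]_(z in `[eps, N]) (k z * f (x - z)).
  have <- := @Rintegral_reflect _ eps N x g (ltW eN) cg.
  by apply: eq_Rintegral => z _; rewrite /g; congr (k _ * _); ring.
have -> : \int[mu]_(y in `[x + eps, x + N]) g y = \int[mu]_(z in `[eps, N]) (k (- z) * f (x + z)).
  rewrite ![x + _]addrC; have <- := @Rintegral_shift _ eps N x g (ltW eN) cg.
  apply: eq_Rintegral => z _; rewrite /g [z + x]addrC; congr (k _ * _); ring.
have cfm : continuous (fun z => f (x - z)) by exact: continuous_comp_sub.
have cfp : continuous (fun z => f (x + z)).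
  by under [X in continuous X]eq_fun do rewrite addrC; exact: continuous_comp_add.
have ckN : continuous (fun z => k (- z)).
  by move=> z; apply: (@continuous_comp _ _ _ -%R k); [exact: continuousN|exact: ck].
rewrite -RintegralD//; [|by apply: continuous_itv_integrable; exact: continuous_mul..].
apply: eq_Rintegral => z; rewrite inE/= in_itv/= => /andP[ez _].
by rewrite kneg// kpos// -/(h z); ring.
Qed.

End FoldedKernel.

Section PrincipalValue.
Context {R : realType}.
Notation mu := (@lebesgue_measure R).
Implicit Types (f v : R -> R) (delta x : R).

Lemma sym_diff_le (f f' : R -> R) B x z : (forall x : R, is_derive x 1 f (f' x)) ->
  (forall x, `|f' x| <= B) -> 0 <= z -> `|f (x - z) - f (x + z)| <= B * (2 * z).
Proof.
move=> df hB z0.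
have [->|zn0] := eqVneq z 0; first by rewrite subr0 addr0 subrr normr0 !mulr0.
have zp : 0 < z by rewrite lt_neqAle eq_sym zn0.
have cf : {within `[x - z, x + z], continuous f}.
  exact/continuous_subspaceT/(is_derive_continuous df).
have xz : x - z < x + z by lra.
have [c _ E] := @MVT _ f f' _ _ xz (fun x _ => df x) cf.
rewrite distrC E normrM (_ : x + z - (x - z) = 2 * z); last by ring.
have z2 : 0 <= 2 * z by rewrite mulr_ge0.
by rewrite (ger0_norm z2) ler_wpM2r.
Qed.

(** The first factor [z] comes from the mean value theorem; the factor
    [1 + z >= 1] brings the bound to the form in which [kappa] is known to be
    integrable. *)
Lemma kappa_diff_le delta f f' B x z : 0 < delta ->
  (forall x : R, is_derive x 1 f (f' x)) -> (forall x, `|f' x| <= B) ->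
  `|kappa delta z * (f (x - z) - f (x + z))| <= 2 * B * (kappa delta z * (z * (1 + z))).
Proof.
move=> d0 df hB; have k0 := kappa_ge0 z d0.
have B0 : 0 <= B by apply: le_trans (hB 0); exact: normr_ge0.
have [z0|z0] := ltP 0 z; last by rewrite kappa_le0// !mul0r mulr0 normr0.
rewrite normrM ger0_norm// mulrCA ler_wpM2l//.
apply: le_trans (sym_diff_le _ df hB (ltW z0)) _.
have -> : B * (2 * z) = 2 * B * (z * 1) by ring.
by rewrite ler_wpM2l ?mulr_ge0// ler_wpM2l ?(ltW z0)// lerDl ltW.
Qed.

Lemma measurable_kappa_diff delta f x : 0 < delta -> continuous f ->
  measurable_fun setT (fun z => kappa delta z * (f (x - z) - f (x + z))).
Proof.
move=> d0 cf; apply: measurable_funM; first exact: measurable_kappa.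
by apply: continuous_measurable_fun; exact: continuous_sym_diff.
Qed.

Lemma integrable_kappa_diff delta f f' B x : 0 < delta ->
  (forall x : R, is_derive x 1 f (f' x)) -> (forall x, `|f' x| <= B) ->
  mu.-integrable setT (EFin \o (fun z => kappa delta z * (f (x - z) - f (x + z)))).
Proof.
move=> d0 df hB.
have iC := integrableZl measurableT (2 * B) (integrable_kappa d0).
apply: (le_integrable measurableT _ _ iC).
  by apply/measurable_EFinP; apply: measurable_kappa_diff => //; exact: is_derive_continuous df.
move=> z _; rewrite lee_fin; apply: le_trans (ler_norm _).
exact: kappa_diff_le.
Qed.

Lemma kappa_conv_le delta f f' B x : 0 < delta ->
  (forall x : R, is_derive x 1 f (f' x)) -> (forall x, `|f' x| <= B) ->
  `|kappa_conv delta f x| <= 2 * B * \int[mu]_z (kappa delta z * (z * (1 + z))).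
Proof.
move=> d0 df hB; have iK := integrable_kappa_diff x d0 df hB.
apply: le_trans (le_normr_Rintegral measurableT iK) _.
rewrite -RintegralZl//; last exact: integrable_kappa.
apply: le_Rintegral => //.
- exact: integrable_norm iK.
- exact: (integrableZl measurableT (2 * B) (integrable_kappa d0)).
- by move=> z _; exact: kappa_diff_le.
Qed.

(* n.+2 rather than n.+1, so that [eps_ n < N_ n] already for n = 0 *)
Let eps_ (n : nat) : R := n.+2%:R^-1.
Let N_ (n : nat) : R := n.+2%:R.

Let eps_cvg0 : eps_ n @[n --> \oo] --> (0 : R).
Proof.
have : (fun n => n.+1%:R^-1 : R) n.+1 @[n --> \oo] --> (0 : R).
  by rewrite (cvg_shiftS (fun n => n.+1%:R^-1 : R)); exact: cvg_harmonic.
by [].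
Qed.

Let N_cvgy : N_ n @[n --> \oo] --> +oo.
Proof.
apply/cvgryPge => A; have /cvgryPge/(_ A) := @cvgr_idn R.
by apply: filterS => n /le_trans; apply; rewrite /N_ ler_nat -addn2 leq_addr.
Qed.

(** Dominated convergence, the truncations being restrictions of one integrable
    function. *)
Lemma Rintegral_kappa_trunc delta f f' B x : 0 < delta ->
  (forall x : R, is_derive x 1 f (f' x)) -> (forall x, `|f' x| <= B) ->
  \int[mu]_(z in `[eps_ n, N_ n]) (kappa delta z * (f (x - z) - f (x + z)))
    @[n --> \oo] --> kappa_conv delta f x.
Proof.
move=> d0 df hB; have iK := integrable_kappa_diff x d0 df hB.
set g := EFin \o _ in iK.
have mg : measurable_fun setT g by exact: measurable_int iK.
have ign : mu.-integrable setT (abse \o g) by exact: integrable_abse.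
have H : (\int[mu]_z (g \_ `[eps_ n, N_ n]) z @[n --> \oo] --> \int[mu]_z g z)%E.
  apply: (@dominated_cvg _ _ _ mu _ measurableT _ g (abse \o g)) => //.
  - by move=> n; apply/(measurable_restrictT _ _).1 => //; exact: measurable_funTS.
  - move=> z _; apply: cvg_near_cst.
    have [z0|z0] := ltP 0 z; last first.
      apply: nearW => n; rewrite patchE; case: ifPn => // _.
      by rewrite /g /= kappa_le0// mul0r.
    have h1 : \forall n \near \oo, eps_ n <= z.
      have /cvgr0_norm_le/(_ _ z0) := eps_cvg0.
      by apply: filterS => n; apply: le_trans; exact: ler_norm.
    have h2 : \forall n \near \oo, z <= N_ n.
      by have /cvgryPge/(_ z) := N_cvgy.
    near=> n; rewrite patchE ifT// inE/= in_itv/=; apply/andP; split; near: n => //.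
  - move=> n z _; rewrite patchE; case: ifPn => _; first exact: lexx.
    by rewrite abse0; exact: abse_ge0.
rewrite (_ : (fun n => _) = fun n => fine (\int[mu]_z (g \_ `[eps_ n, N_ n]) z)%E).
  rewrite /kappa_conv /Rintegral; apply: fine_cvg; rewrite fineK//.
  exact: (integrable_fin_num measurableT iK).
by apply/funext => n; rewrite /Rintegral [in LHS]integral_mkcond.
Unshelve. all: by end_near. Qed.

(** On [z > 0], coth is [1 + kappa]. The constant 1 integrates [v''] back to
    [v'], which produces [2 v'(x)] from the end of the truncation near [x],
    while the boundary terms at distance [N_ n] disappear because [v'] decays at
    infinity. The principal value is a limit along a filter of pairs, of which
    one sequence is enough to identify the value. *)
Lemma is_Tdelta_kappa_conv delta v1 v2 v3 B x l : 0 < delta ->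
  (forall x : R, is_derive x 1 v1 (v2 x)) ->
  (forall x : R, is_derive x 1 v2 (v3 x)) ->
  L2 v1 -> L2 v2 -> (forall x, `|v3 x| <= B) ->
  is_Tdelta delta v2 x l ->
  l + delta^-1 * v1 x = - (delta *+ 2)^-1 * kappa_conv delta v2 x.
Proof.
move=> d0 d1 d2 L1 L2' hB hT.
have c2 := is_derive_continuous d2; have c1 := is_derive_continuous d1.
have e0 n : 0 < eps_ n by rewrite invr_gt0 ltr0n.
have eN n : eps_ n < N_ n.
  by rewrite /eps_ /N_ (@lt_trans _ _ 1)// ?invf_lt1 ?ltr1n ?ltr0n.
(* one sequence that tends to the filter of the principal value *)
have seq : (fun n => (eps_ n, N_ n)) @ \oo --> filter_prod (0 : R)^'+ (pinfty_nbhs R).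
  move=> P [[P1 P2] [/= h1 h2] sub].
  have e1 : \forall n \near \oo, 0 < eps_ n -> P1 (eps_ n) := eps_cvg0 h1.
  have e2 : \forall n \near \oo, P2 (N_ n) := N_cvgy h2.
  have : \forall n \near \oo, P (eps_ n, N_ n); last by [].
  by apply: filterS2 e1 e2 => n p1 p2; exact: (sub (eps_ n, N_ n) (conj (p1 (e0 n)) p2)).
pose S n := \int[mu]_(z in `[eps_ n, N_ n]) (kappa delta z * (v2 (x - z) - v2 (x + z))).
pose A n := - v1 (x - N_ n) - v1 (x + N_ n) - (- v1 (x - eps_ n) - v1 (x + eps_ n)).
have E n : \int[mu]_(y in [set y | eps_ n < `|x - y| < N_ n])
       (coth (pi * (x - y) / (delta *+ 2)) * v2 y) = S n + A n.
  rewrite Rintegral_annulus//.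
  have cD : continuous (fun z => v2 (x - z) - v2 (x + z)).
    exact: continuous_sym_diff.
  have <- : \int[mu]_(z in `[eps_ n, N_ n]) (v2 (x - z) - v2 (x + z)) = A n.
    apply: (@Rintegral_FTC _ _ _ _ (fun z => - v1 (x - z) - v1 (x + z)) (ltW (eN n)) cD) => z.
    have h1 := is_derive_comp_sub x z d1; have h2 := is_derive_comp_add x z d1.
    by apply: is_derive_eq; rewrite opprK.
  rewrite -RintegralD//; last 2 first.
  - by apply: integrableS (integrable_kappa_diff x d0 d2 hB).
  - exact: continuous_itv_integrable.
  apply: eq_Rintegral => z; rewrite inE/= in_itv/= => /andP[ez _].
  have z0 : 0 < z by apply: lt_le_trans ez.
  by rewrite /kappa z0 (max_idPr ez) [pi * z / _]mulrAC; ring.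
have Alim : A n @[n --> \oo] --> 2 * v1 x.
  have nN : `|N_ n| @[n --> \oo] --> +oo.
    by apply/cvgryPge => a; have /cvgryPge/(_ a) := N_cvgy; apply: filterS => n /le_trans;
      apply; exact: ler_norm.
  have nm : `|x - N_ n| @[n --> \oo] --> +oo.
    apply/cvgryPge => a; have /cvgryPge/(_ (a + `|x|)) := N_cvgy; apply: filterS => n h.
    rewrite (distrC x (N_ n)); have := lerB_dist (N_ n) x; have := ler_norm (N_ n); lra.
  have np : `|x + N_ n| @[n --> \oo] --> +oo.
    apply/cvgryPge => a; have /cvgryPge/(_ (a + `|x|)) := N_cvgy; apply: filterS => n h.
    rewrite (addrC x (N_ n)); have := lerB_normD (N_ n) x; have := ler_norm (N_ n); lra.
  have l1 := H1_cvg0 c2 d1 L1 L2' nm.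
  have l2 := H1_cvg0 c2 d1 L1 L2' np.
  have l3 : v1 (x - eps_ n) @[n --> \oo] --> v1 x.
    have : x - eps_ n @[n --> \oo] --> x by rewrite -[X in _ --> X]subr0;
      apply: cvgB => //; exact: cvg_cst.
    by move=> h; apply: (cvg_comp _ _ h); exact: c1.
  have l4 : v1 (x + eps_ n) @[n --> \oo] --> v1 x.
    have : x + eps_ n @[n --> \oo] --> x by rewrite -[X in _ --> X]addr0;
      apply: cvgD => //; exact: cvg_cst.
    by move=> h; apply: (cvg_comp _ _ h); exact: c1.
  rewrite (_ : 2 * v1 x = - 0 - 0 - (- v1 x - v1 x)); last by ring.
  by apply: cvgB; apply: cvgB => //; exact: cvgN.
have SA : - (delta *+ 2)^-1 * (S n + A n) @[n --> \oo] -->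
    - (delta *+ 2)^-1 * (kappa_conv delta v2 x + 2 * v1 x).
  apply: cvgM; first exact: cvg_cst.
  by apply: cvgD => //; exact: Rintegral_kappa_trunc d0 d2 hB.
have := cvg_comp _ _ seq hT.
rewrite (_ : _ \o _ = fun n => - (delta *+ 2)^-1 * (S n + A n)); last first.
  by apply/funext => n; rewrite /= E.
move=> lim; have -> := cvg_unique (@norm_hausdorff _ _) lim SA.
by rewrite -mulr_natr; field; rewrite gt_eqF.
Qed.

End PrincipalValue.

(** * The dispersive term against a test function *)

Section Pairing.
Context {R : realType}.
Notation mu := (@lebesgue_measure R).
Implicit Types (f v : R -> R) (delta x : R).

Lemma Rintegral_itv_support a b c d f : (forall x, f x != 0 -> a <= x <= b) ->
  c <= a -> b <= d ->
  \int[mu]_(x in `[c, d]) f x = \int[mu]_(x in `[a, b]) f x.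
Proof.
move=> hf ca bd; rewrite Rintegral_mkcond [RHS]Rintegral_mkcond.
apply: eq_Rintegral => x _; rewrite !patchE.
have [->|fx] := eqVneq (f x) 0; first by do 2 case: ifPn.
have /andP[ax xb] := hf _ fx.
by rewrite !ifT// inE/= in_itv/= ?ax ?(le_trans ca) ?(le_trans xb).
Qed.

Lemma Rintegral_support a b f : (forall x, f x != 0 -> a <= x <= b) ->
  \int[mu]_x f x = \int[mu]_(x in `[a, b]) f x.
Proof.
move=> hf; rewrite [RHS]Rintegral_mkcond.
apply: eq_Rintegral => x _; rewrite !patchE; case: ifPn => //.
move=> /negP; rewrite inE/= in_itv/= => h.
by have [//|/hf] := eqVneq (f x) 0.
Qed.

Section test_function.
Variables (phi phi1 phi2 : R -> R) (L K : R).
Hypotheses (dphi : forall x : R, is_derive x 1 phi (phi1 x))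
  (dphi1 : forall x : R, is_derive x 1 phi1 (phi2 x))
  (Kphi2 : forall x y, `|phi2 x - phi2 y| <= K * `|x - y|)
  (phi0 : forall x, L <= `|x| -> phi x = 0)
  (phi10 : forall x, L <= `|x| -> phi1 x = 0)
  (phi20 : forall x, L <= `|x| -> phi2 x = 0)
  (L1 : 1 <= L) (cphi2 : continuous phi2).

Let LL : - L <= L. Proof. by move: L1 => ?; lra. Qed.
Let pL : L <= `|L|. Proof. exact: ler_norm. Qed.
Let pNL : L <= `|- L|. Proof. by rewrite normrN. Qed.

(** Enlarging the segment to [-A, A] makes the right-hand sides for [s] and
    [- s] comparable: they are integrals over the same segment. *)
Lemma Rintegral_by_parts2 v v1 v2 s A : continuous v2 ->
  (forall x : R, is_derive x 1 v (v1 x)) ->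
  (forall x : R, is_derive x 1 v1 (v2 x)) ->
  L + `|s| <= A ->
  \int[mu]_(x in `[- L, L]) (phi x * v2 (x + s)) =
  \int[mu]_(y in `[- A, A]) (phi2 (y - s) * v y).
Proof.
move=> cv2 dv dv1 LA.
have cv1 := is_derive_continuous dv1; have cv := is_derive_continuous dv.
have dvs (x : R) : is_derive x 1 (fun x => v (x + s)) (v1 (x + s)).
  by have := is_derive_comp_add s x dv; rewrite addrC; under eq_fun do rewrite addrC.
have dv1s (x : R) : is_derive x 1 (fun x => v1 (x + s)) (v2 (x + s)).
  by have := is_derive_comp_add s x dv1; rewrite addrC; under eq_fun do rewrite addrC.
have cv2s : continuous (fun x => v2 (x + s)) by exact: continuous_comp_add.
have cv1s : continuous (fun x => v1 (x + s)) by exact: continuous_comp_add.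
rewrite (Rintegral_by_parts LL (is_derive_continuous dphi1) cv2s dphi dv1s).
rewrite (Rintegral_by_parts LL cphi2 cv1s dphi1 dvs).
rewrite !phi0 ?phi10// !mul0r !(subr0, sub0r, oppr0, opprK).
have cg : continuous (fun y => phi2 (y - s) * v y).
  by apply: continuous_mul => //; exact: continuous_comp_add.
have := Rintegral_shift s LL cg.
under eq_Rintegral do rewrite addrK.
move=> ->; symmetry; apply: Rintegral_itv_support.
- move=> x; apply: contraNT => h; rewrite phi20 ?mul0r//.
  by move: h; rewrite ler_normr; lra.
- by have := ler_norm (- s); rewrite normrN; lra.
- by have := ler_norm s; lra.
Qed.

(** Moving both derivatives onto the test function costs only a difference of
    values of [phi2] at distance [2 z], hence a factor [z] that tames [kappa].
    The factor [1 + z] accounts for the length of the support of the shifted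
    test functions. *)
Lemma Rintegral_diff_le v v1 v2 M z : continuous v2 ->
  (forall x : R, is_derive x 1 v (v1 x)) ->
  (forall x : R, is_derive x 1 v1 (v2 x)) ->
  0 < M -> (L2norm v <= M%:E)%E -> 0 < z ->
  `|\int[mu]_(x in `[- L, L]) (phi x * (v2 (x - z) - v2 (x + z)))| <=
    2 * K * M * Num.sqrt (2 * L) * (z * (1 + z)).
Proof.
move=> cv2 dv dv1 M0 hv z0; have cv := is_derive_continuous dv.
have cphi := is_derive_continuous dphi.
have K0 : 0 <= K.
  have := Kphi2 1 0; rewrite subr0 normr1 mulr1; apply: le_trans; exact: normr_ge0.
have ic s : mu.-integrable `[- L, L] (EFin \o (fun x => phi x * v2 (x + s))).
  apply: continuous_itv_integrable; apply: continuous_mul => //.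
  exact: continuous_comp_add.
have -> : \int[mu]_(x in `[- L, L]) (phi x * (v2 (x - z) - v2 (x + z))) =
   \int[mu]_(x in `[- L, L]) (phi x * v2 (x - z)) - \int[mu]_(x in `[- L, L]) (phi x * v2 (x + z)).
  by rewrite -RintegralB//; apply: eq_Rintegral => x _; rewrite mulrBr.
pose A := L + z.
have zA : L + `|z| <= A by rewrite gtr0_norm.
have zA' : L + `|- z| <= A by rewrite normrN.
rewrite (Rintegral_by_parts2 cv2 dv dv1 zA) (Rintegral_by_parts2 cv2 dv dv1 zA').
have cs s : continuous (fun x => phi2 (x - s) * v x).
  by apply: continuous_mul => //; exact: continuous_comp_add.
rewrite -RintegralB//; [|exact: continuous_itv_integrable..].
have cd : continuous (fun x => phi2 (x - - z) * v x - phi2 (x - z) * v x).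
  by move=> x; apply: cvgB; exact: cs.
apply: le_trans (normr_Rintegral_itv _ _ cd) _.
have cn := continuous_norm cv.
have ck : continuous (fun x => 2 * K * z * `|v x|).
  by apply: continuous_mul => // x; exact: cst_continuous.
apply: (@le_trans _ _ (\int[mu]_(x in `[- A, A]) (2 * K * z * `|v x|))).
  apply: le_Rintegral_itv => //; first exact: continuous_norm.
  move=> x _; rewrite -mulrBl normrM ler_wpM2r//.
  apply: le_trans (Kphi2 _ _) _.
  rewrite (_ : x - - z - (x - z) = 2 * z); last by ring.
  by rewrite ger0_norm; [lra|rewrite mulr_ge0// ltW].
rewrite RintegralZl//; last exact: continuous_itv_integrable.
have AA : - A < A by rewrite /A; move: L1; lra.
have h := Rintegral_norm_le_L2norm cv AA M0 hv.
have sA : Num.sqrt (A - - A) <= Num.sqrt (2 * L) * (1 + z).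
  have z10 : 0 <= 1 + z by rewrite addr_ge0// ltW.
  rewrite -[X in _ * X](ger0_norm z10) -sqrtr_sqr -sqrtrM;
    last by rewrite mulr_ge0// (le_trans _ L1).
  by rewrite ler_wsqrtr// /A; move: L1 => ?; nra.
have -> : 2 * K * M * Num.sqrt (2 * L) * (z * (1 + z)) =
  2 * K * z * (M * (Num.sqrt (2 * L) * (1 + z))) by ring.
rewrite ler_wpM2l ?mulr_ge0//; first by rewrite (ltW z0).
by apply: le_trans h _; rewrite ler_wpM2l// ltW.
Qed.

End test_function.
End Pairing.

Section PairingFubini.
Context {R : realType}.
Notation mu := (@lebesgue_measure R).
Implicit Types (f v : R -> R) (delta x : R).
Variables (delta L B : R) (phi v2 v3 : R -> R).
Hypotheses (d0 : 0 < delta) (cphi : continuous phi)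
  (phi0 : forall x, L <= `|x| -> phi x = 0)
  (dv2 : forall x : R, is_derive x 1 v2 (v3 x)) (hB : forall x, `|v3 x| <= B).

Let w z : R := kappa delta z * (z * (1 + z)).
Let F (p : R * R) : R := phi p.1 * (kappa delta p.2 * (v2 (p.1 - p.2) - v2 (p.1 + p.2))).

Let supp_phi x : phi x != 0 -> - L <= x <= L.
Proof.
move=> h; have : ~~ (L <= `|x|) by apply: contra h => /phi0 ->.
by rewrite -ltNge ltr_norml => /andP[h1 h2]; rewrite !ltW.
Qed.

Let integrable_phi : mu.-integrable setT (EFin \o phi).
Proof.
have := (@integrable_mkcond _ _ _ mu _ _ (measurable_itv _)).1
  (@continuous_itv_integrable _ (- L) L phi cphi).
rewrite (_ : _ \_ _ = EFin \o phi)//; apply/funext => x.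
rewrite patchE; case: ifPn => //; rewrite notin_setE/= in_itv/= => h.
by have [->//|/supp_phi] := eqVneq (phi x) 0.
Qed.

Let mF : measurable_fun setT F.
Proof.
have cv2 := is_derive_continuous dv2.
apply: measurable_funM.
  by apply: (measurableT_comp (continuous_measurable_fun cphi)).
apply: measurable_funM.
  by apply: (measurableT_comp (measurable_kappa d0)).
apply: measurable_funB; apply: (measurableT_comp (continuous_measurable_fun cv2)).
  exact: measurable_funB.
exact: measurable_funD.
Qed.

Let iF : (mu \x mu)%E.-integrable setT (EFin \o F).
Proof.
apply/integrable12ltyP; first exact/measurable_EFinP.
have iw := integrable_kappa d0.
have w0 z : 0 <= w z by exact: kappa_weight_ge0.
have B0 : 0 <= B by apply: le_trans (hB 0); exact: normr_ge0.
have c0 : (0 <= (2 * B)%:E * \int[mu]_z (w z)%:E)%E.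
  by apply: mule_ge0; [rewrite lee_fin mulr_ge0|apply: integral_ge0 => z _; rewrite lee_fin].
apply: (@le_lt_trans _ _ (\int[mu]_x ((2 * B)%:E * (\int[mu]_z (w z)%:E) * `|(phi x)%:E|))%E).
  apply: ge0_le_integral => //.
  - by move=> x _; exact: integral_ge0.
  - have := @measurable_fun_fubini_tonelli_F _ _ _ _ _ mu (abse \o (EFin \o F)).
    apply; last by move=> x; exact: abse_ge0.
    by apply: measurableT_comp => //; exact/measurable_EFinP.
  - apply: measurable_funeM; apply: measurableT_comp => //.
    by apply/measurable_EFinP; exact: continuous_measurable_fun.
  - move=> x _.
    rewrite muleC muleA -EFinM -ge0_integralZl//; last 3 first.
    + exact: measurable_int iw.
    + by move=> z _; rewrite lee_fin.
    + by rewrite lee_fin mulr_ge0// mulr_ge0.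
    apply: ge0_le_integral => //.
    + apply: measurableT_comp => //; apply/measurable_EFinP.
      by apply: (measurableT_comp mF).
    + apply: measurable_funeM; exact: measurable_int iw.
    + move=> z _; rewrite lee_fin /F/= normrM -mulrA ler_wpM2l//.
      exact: kappa_diff_le dv2 hB.
rewrite ge0_integralZl//; last first.
  by apply: measurableT_comp => //; apply/measurable_EFinP; exact: continuous_measurable_fun.
apply: lte_mul_pinfty.
- exact: c0.
- by rewrite fin_numM// (integrable_fin_num measurableT iw).
- by case/integrableP : integrable_phi.
Qed.

(** By Fubini, since the integrand on the plane is dominated by [|phi x|] times
    an integrable function of [z]. *)
Lemma kappa_conv_pairing_integrable :
  mu.-integrable setT (EFin \o (fun x => phi x * kappa_conv delta v2 x)).
Proof.
have := integrable_fubini_F iF; apply: eq_integrable => // x _.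
rewrite /fubini_F /= /F /= /kappa_conv -RintegralZl//.
  rewrite /Rintegral fineK//.
  apply: (integrable_fin_num measurableT).
  exact: (integrableZl measurableT (phi x) (integrable_kappa_diff x d0 dv2 hB)).
exact: integrable_kappa_diff dv2 hB.
Qed.

Let G z : R := kappa delta z * \int[mu]_(x in `[- L, L]) (phi x * (v2 (x - z) - v2 (x + z))).

Let GE z : fubini_G mu (EFin \o F) z = (G z)%:E.
Proof.
have cv2 := is_derive_continuous dv2.
have cD : continuous (fun x => phi x * (v2 (x - z) - v2 (x + z))).
  apply: continuous_mul => // x; apply: cvgB.
    exact: (@continuous_comp_add _ v2 (- z) cv2 x).
  exact: (@continuous_comp_add _ v2 z cv2 x).
have supp x : F (x, z) != 0 -> - L <= x <= L.
  move=> h; apply: supp_phi; apply: contra h => /eqP h.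
  by rewrite /F/= h mul0r.
have iD := @continuous_itv_integrable _ (- L) L _ cD.
rewrite /G -RintegralZl//.
have <- : \int[mu]_x F (x, z) = \int[mu]_(x in `[- L, L]) (kappa delta z * (phi x * (v2 (x - z) - v2 (x + z)))).
  by rewrite (Rintegral_support supp); apply: eq_Rintegral => x _; rewrite /F/=; ring.
rewrite /Rintegral fineK//; apply: (integrable_fin_num measurableT).
have iK := (fun mD => integrableZl mD (kappa delta z) iD) (measurable_itv _).
have := (@integrable_mkcond _ _ _ mu _ _ (measurable_itv _)).1 iK;
  apply: eq_integrable => // x _.
rewrite patchE; case: ifPn => [_|].
  by rewrite /F/= -EFinM; congr EFin; ring.
rewrite notin_setE/= in_itv/= => h.
by have [->//|/supp] := eqVneq (F (x, z)) 0.
Qed.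

Lemma kappa_conv_pairing_swap :
  \int[mu]_(x in `[- L, L]) (phi x * kappa_conv delta v2 x) = \int[mu]_z G z /\
  measurable_fun setT G.
Proof.
split; last first.
  apply/measurable_EFinP; have := measurable_fubini_G iF.
  by apply: eq_measurable_fun => z _; exact: GE.
rewrite -Rintegral_support; last first.
  by move=> x h; apply: supp_phi; apply: contra h => /eqP ->; rewrite mul0r.
have FE x : fubini_F mu (EFin \o F) x = (phi x * kappa_conv delta v2 x)%:E.
  rewrite /fubini_F /= /F /= /kappa_conv -RintegralZl//.
    rewrite /Rintegral fineK//.
    apply: (integrable_fin_num measurableT).
    exact: (integrableZl measurableT (phi x) (integrable_kappa_diff x d0 dv2 hB)).
  exact: integrable_kappa_diff dv2 hB.
rewrite /Rintegral; congr fine.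
transitivity (\int[mu]_x fubini_F mu (EFin \o F) x)%E.
  by apply: eq_integral => x _; rewrite FE.
rewrite /fubini_F Fubini//.
by apply: eq_integral => z _; rewrite -GE.
Qed.

End PairingFubini.

Section PairingBound.
Context {R : realType}.
Notation mu := (@lebesgue_measure R).

(** With the integral over [z] outermost, the two derivatives of [v] can be
    moved to [phi] for each [z] separately. *)
Lemma kappa_conv_pairing_le (delta L K M B : R) (phi phi1 phi2 v v1 v2 v3 : R -> R) :
  0 < delta ->
  (forall x : R, is_derive x 1 phi (phi1 x)) ->
  (forall x : R, is_derive x 1 phi1 (phi2 x)) ->
  (forall x y, `|phi2 x - phi2 y| <= K * `|x - y|) ->
  (forall x, L <= `|x| -> phi x = 0) -> (forall x, L <= `|x| -> phi1 x = 0) ->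
  (forall x, L <= `|x| -> phi2 x = 0) -> 1 <= L -> continuous phi2 ->
  (forall x : R, is_derive x 1 v (v1 x)) ->
  (forall x : R, is_derive x 1 v1 (v2 x)) ->
  (forall x : R, is_derive x 1 v2 (v3 x)) -> (forall x, `|v3 x| <= B) ->
  0 < M -> (L2norm v <= M%:E)%E ->
  `|\int[mu]_(x in `[- L, L]) (phi x * kappa_conv delta v2 x)| <=
    2 * K * M * Num.sqrt (2 * L) * \int[mu]_z (kappa delta z * (z * (1 + z))).
Proof.
move=> d0 dp dp1 Kp p0 p10 p20 L1 cp2 dv dv1 dv2 hB M0 hv.
have cphi := is_derive_continuous dp; have cv2 := is_derive_continuous dv2.
have [-> mG] := kappa_conv_pairing_swap d0 cphi p0 dv2 hB.
set G := fun z => _ in mG *; set C := 2 * K * M * Num.sqrt (2 * L).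
have iw := integrable_kappa d0.
have K0 : 0 <= K.
  have := Kp 1 0; rewrite subr0 normr1 mulr1; apply: le_trans; exact: normr_ge0.
have GC z : `|G z| <= C * (kappa delta z * (z * (1 + z))).
  rewrite /G; have [z0|z0] := ltP 0 z; last by rewrite kappa_le0// !mul0r mulr0 normr0.
  rewrite normrM (ger0_norm (kappa_ge0 _ d0)) mulrCA ler_wpM2l ?kappa_ge0//.
  exact: Rintegral_diff_le.
have iC := integrableZl measurableT C iw.
have iG : mu.-integrable setT (EFin \o G).
  apply: (le_integrable measurableT _ _ iC); first exact/measurable_EFinP.
  by move=> z _; rewrite lee_fin; apply: le_trans (GC z) _; exact: ler_norm.
apply: le_trans (le_normr_Rintegral measurableT iG) _.
rewrite -RintegralZl//; apply: le_Rintegral => //; exact: integrable_norm iG.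
Qed.

End PairingBound.

(** * A smoothed step *)

Section TestFunction.
Context {R : realType}.
Implicit Types (x y a b t h : R).

(** A second-order bound on the remainder is easier to check for piecewise
    defined functions than a difference quotient. *)
Lemma is_derive_taylor (f : R -> R) t c K :
  (forall h, `|f (t + h) - f t - c * h| <= K * h ^+ 2) -> is_derive t 1 f c.
Proof.
move=> hK.
have H : (fun h : R => h^-1 *: (f (h *: 1 + t) - f t)) @ 0^' --> c.
  apply/cvgrPdist_lt => e e0.
  pose d := e / (`|K| + 1).
  have K1 : 0 < `|K| + 1 by rewrite ltr_wpDl.
  have d0 : 0 < d by rewrite divr_gt0.
  near=> h.
  have h0 : h != 0 by near: h; exact: nbhs_dnbhs_neq.
  have hd : `|h| < d by near: h; apply: dnbhs0_lt.
  rewrite distrC /GRing.scale/= mulr1 [h + t]addrC.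
  have -> : h^-1 * (f (t + h) - f t) - c = h^-1 * (f (t + h) - f t - c * h).
    by field.
  rewrite normrM normfV ltr_pdivrMl ?normr_gt0//.
  apply: le_lt_trans (hK h) _.
  rewrite -real_normK ?num_real// expr2 mulrCA ltr_pM2l ?normr_gt0//.
  have := ler_norm K; have := normr_ge0 h.
  rewrite /d ltr_pdivlMr// in hd; nra.
by apply: DeriveDef; [apply/cvg_ex; exists c|exact/cvg_lim].
Unshelve. all: by end_near. Qed.

Definition clamp x : R := Num.max (- 1) (Num.min x 1).

Lemma clamp_bounds x : -1 <= clamp x <= 1.
Proof. by rewrite /clamp /Num.max /Num.min; do 2 case: ifPn; rewrite -?leNgt; lra. Qed.

Lemma clamp_id x : -1 <= x <= 1 -> clamp x = x.
Proof. by rewrite /clamp /Num.max /Num.min; do 2 case: ifPn; rewrite -?leNgt; lra. Qed.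

Lemma clamp_ge1 x : 1 <= x -> clamp x = 1.
Proof. by rewrite /clamp /Num.max /Num.min; do 2 case: ifPn; rewrite -?leNgt; lra. Qed.

Lemma clamp_leN1 x : x <= -1 -> clamp x = -1.
Proof. by rewrite /clamp /Num.max /Num.min; do 2 case: ifPn; rewrite -?leNgt; lra. Qed.

Lemma clamp_cases x : [\/ x <= -1 /\ clamp x = -1, -1 <= x <= 1 /\ clamp x = x
  | 1 <= x /\ clamp x = 1].
Proof.
have [h|h] := leP x (-1); first by apply: Or31; split => //; exact: clamp_leN1.
have [h'|h'] := leP 1 x; first by apply: Or33; split => //; exact: clamp_ge1.
by apply: Or32; split; [lra|apply: clamp_id; lra].
Qed.

Lemma clamp_lip x y : `|clamp x - clamp y| <= `|x - y|.
Proof.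
wlog xy : x y / x <= y.
  move=> H; have [/H//|/ltW /H] := leP x y.
  by rewrite distrC [X in _ <= X]distrC.
rewrite distrC [X in _ <= X]distrC [X in _ <= X]ger0_norm ?subr_ge0//.
have [[h ->]|[h ->]|[h ->]] := clamp_cases x;
  have [[h' ->]|[h' ->]|[h' ->]] := clamp_cases y; rewrite ger0_norm; lra.
Qed.

(** Stopping at [-1] and [1] does not break differentiability when the
    derivative vanishes there. *)
Lemma is_derive_clamp (q q' : R -> R) K t :
  (forall a b, -1 <= a <= 1 -> -1 <= b <= 1 ->
     `|q a - q b - q' b * (a - b)| <= K * (a - b) ^+ 2) ->
  (forall a, -1 <= a <= 1 -> `|q' a| <= K * (1 - a) /\ `|q' a| <= K * (1 + a)) ->
  is_derive t 1 (fun x => q (clamp x)) (q' (clamp t)).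
Proof.
move=> hq hq'; apply: (@is_derive_taylor _ _ _ (2 * K)) => h.
have K0 : 0 <= K by have [+ _] := hq' 0 ltac:(lra); have := normr_ge0 (q' 0); lra.
set a := clamp (t + h); set b := clamp t.
have hab : (a - b) ^+ 2 <= h ^+ 2.
  rewrite -[X in X <= _]real_normK ?num_real// -[X in _ <= X]real_normK ?num_real//.
  by rewrite ler_sqr ?nnegrE//; have := clamp_lip (t + h) t; rewrite addrAC subrr add0r.
have -> : q a - q b - q' b * h = (q a - q b - q' b * (a - b)) + q' b * (a - b - h) by ring.
apply: le_trans (ler_normD _ _) _.
have h1 := hq _ _ (clamp_bounds (t + h)) (clamp_bounds t); rewrite -/a -/b in h1.
suff : `|q' b * (a - b - h)| <= K * h ^+ 2 by nra.
rewrite normrM; have [b1 b2] := hq' _ (clamp_bounds t); rewrite -/b in b1 b2.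
have q0 := normr_ge0 (q' b).
have z0 : `|q' b| <= 0 -> `|q' b| * `|a - b - h| <= K * h ^+ 2.
  move=> le0; have -> : `|q' b| = 0 by lra.
  by rewrite mul0r mulr_ge0// sqr_ge0.
have [[ht bE]|[ht bE]|[ht bE]] := clamp_cases t; rewrite -/b in bE.
- by apply: z0; move: b2; rewrite bE subrr mulr0.
- have [[ha aE]|[ha aE]|[ha aE]] := clamp_cases (t + h); rewrite -/a in aE.
  + have -> : K * h ^+ 2 = (K * - h) * (- h) by ring.
    rewrite aE; apply: ler_pM => //; last by rewrite ler_norml bE; lra.
    by apply: le_trans b2 _; rewrite ler_wpM2l// bE; lra.
  + rewrite aE bE; have -> : t + h - t - h = 0 by ring.
    by rewrite normr0 mulr0 mulr_ge0 ?sqr_ge0.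
  + have -> : K * h ^+ 2 = (K * h) * h by ring.
    rewrite aE; apply: ler_pM => //; last by rewrite ler_norml bE; lra.
    by apply: le_trans b1 _; rewrite ler_wpM2l// bE; lra.
- by apply: z0; move: b1; rewrite bE subrr mulr0.
Qed.

(** The antiderivative of [(1 - y^2)^2] stopped at [-1] and [1]. The double
    zeros there make the step twice differentiable with a Lipschitz second
    derivative, which is all the regularity required of a test function. *)
Definition smooth_step x : R := clamp x - 2 / 3 * clamp x ^+ 3 + 1 / 5 * clamp x ^+ 5.
Definition quartic_bump x : R := (1 - clamp x ^+ 2) ^+ 2.
Definition quartic_bump' x : R := - 4 * clamp x * (1 - clamp x ^+ 2).

Lemma norm_le1 a : -1 <= a <= 1 -> `|a| <= 1.
Proof. by rewrite ler_norml. Qed.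

Lemma is_derive_smooth_step x : is_derive x 1 smooth_step (quartic_bump x).
Proof.
apply: (@is_derive_clamp (fun a => a - 2 / 3 * a ^+ 3 + 1 / 5 * a ^+ 5)
  (fun a => (1 - a ^+ 2) ^+ 2) 4).
- move=> a b ha hb.
  rewrite (_ : _ - _ - _ = (- (2 / 3) * (a + 2 * b) +
    1 / 5 * (a ^+ 3 + 2 * a ^+ 2 * b + 3 * a * b ^+ 2 + 4 * b ^+ 3)) * (a - b) ^+ 2);
      last by field.
  rewrite normrM (ger0_norm (sqr_ge0 (a - b))) ler_wpM2r ?sqr_ge0//.
  have m x1 y1 : -1 <= x1 <= 1 -> -1 <= y1 <= 1 -> -1 <= x1 * y1 <= 1 by move=> ? ?; nra.
  have haa := m _ _ ha ha; have hbb := m _ _ hb hb.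
  have h3 := m _ _ ha haa; have h4 := m _ _ haa hb; have h5 := m _ _ ha hbb;
    have h6 := m _ _ hb hbb.
  rewrite ler_norml !exprS expr0 !mulr1; lra.
- move=> a ha; rewrite ger0_norm ?sqr_ge0//.
  have : 0 <= a ^+ 2 <= 1 by nra.
  move=> h; split; nra.
Qed.

Lemma is_derive_quartic_bump x : is_derive x 1 quartic_bump (quartic_bump' x).
Proof.
apply: (@is_derive_clamp (fun a => (1 - a ^+ 2) ^+ 2)
  (fun a => - 4 * a * (1 - a ^+ 2)) 8).
- move=> a b ha hb.
  rewrite (_ : _ - _ - _ = (- 2 + a ^+ 2 + 2 * a * b + 3 * b ^+ 2) * (a - b) ^+ 2);
    last by ring.
  rewrite normrM (ger0_norm (sqr_ge0 (a - b))) ler_wpM2r ?sqr_ge0//.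
  rewrite ler_norml; nra.
- move=> a ha.
  have -> : - 4 * a * (1 - a ^+ 2) = (- 4 * a) * ((1 - a) * (1 + a)) by ring.
  rewrite !normrM (@ger0_norm _ (1 - a)); last lra.
  rewrite (@ger0_norm _ (1 + a)); last lra.
  have n1 := norm_le1 ha; rewrite normrN normr_nat.
  have n0 := normr_ge0 a; move: (`|a|) n0 n1 => n n0 n1.
  have k1 : n * (1 + a) <= 2 by nra.
  have k2 : n * (1 - a) <= 2 by nra.
  have p1 : 0 <= (1 - a) * (2 - n * (1 + a)) by apply: mulr_ge0; lra.
  have p2 : 0 <= (1 + a) * (2 - n * (1 - a)) by apply: mulr_ge0; lra.
  by split; lra.
Qed.

Lemma quartic_bump'_lip x y : `|quartic_bump' x - quartic_bump' y| <= 8 * `|x - y|.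
Proof.
apply: le_trans (ler_wpM2l _ (clamp_lip x y)) => //.
rewrite /quartic_bump'; have := clamp_bounds x; have := clamp_bounds y.
move: (clamp x) (clamp y) => a b hb ha.
rewrite (_ : _ - _ = (- 4 + 4 * (a ^+ 2 + a * b + b ^+ 2)) * (a - b)); last by ring.
rewrite normrM ler_wpM2r// ler_norml; nra.
Qed.

Lemma quartic_bump_ge0 x : 0 <= quartic_bump x. Proof. exact: sqr_ge0. Qed.

Lemma quartic_bump_le1 x : quartic_bump x <= 1.
Proof.
rewrite /quartic_bump; have := clamp_bounds x; move: (clamp x) => a ha.
have h : 0 <= a ^+ 2 <= 1 by nra.
nra.
Qed.

Lemma quartic_bump_ge_half x : `|x| <= 1 / 2 -> 1 / 2 <= quartic_bump x.
Proof.
rewrite ler_norml => h; rewrite /quartic_bump clamp_id; last lra.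
have h1 : x ^+ 2 <= 1 / 4 by nra.
have h2 := sqr_ge0 x; nra.
Qed.

Lemma norm_smooth_step_le x : `|smooth_step x| <= 2.
Proof.
rewrite /smooth_step; have := clamp_bounds x; move: (clamp x) => a ha.
have m x1 y1 : -1 <= x1 <= 1 -> -1 <= y1 <= 1 -> -1 <= x1 * y1 <= 1 by move=> ? ?; nra.
have haa := m _ _ ha ha; have h3 := m _ _ ha haa; have h5 := m _ _ h3 haa.
rewrite (_ : a ^+ 3 = a * (a * a)); last by ring.
rewrite (_ : a ^+ 5 = a * (a * a) * (a * a)); last by ring.
rewrite ler_norml; lra.
Qed.

Lemma quartic_bump_eq0 x : 1 <= `|x| -> quartic_bump x = 0.
Proof.
rewrite ler_normr /quartic_bump => /orP[h|h].
  by rewrite clamp_ge1//; ring.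
by rewrite clamp_leN1; [ring|lra].
Qed.

Lemma quartic_bump'_eq0 x : 1 <= `|x| -> quartic_bump' x = 0.
Proof.
rewrite ler_normr /quartic_bump' => /orP[h|h].
  by rewrite clamp_ge1//; ring.
by rewrite clamp_leN1; [ring|lra].
Qed.

Lemma smooth_step_eq x y : 1 <= `|x| -> 1 <= `|y| -> 0 <= x * y ->
  smooth_step x = smooth_step y.
Proof.
rewrite !ler_normr /smooth_step => /orP[h|h] /orP[h'|h'] xy; first by rewrite !clamp_ge1.
- by exfalso; nra.
- by exfalso; nra.
- by rewrite !clamp_leN1//; lra.
Qed.

End TestFunction.

(** * The momentum of a smooth solution *)

Section SmoothSolution.
Context {R : realType}.
Notation mu := (@lebesgue_measure R).
Implicit Types (delta x t : R) (f v : R -> R) (w : R -> R -> R).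

Lemma Hinfty_is_derive f k x : Hinfty f ->
  is_derive x 1 (derive1n k f) (derive1n k.+1 f x).
Proof.
move=> hf; apply: DeriveDef; first by have [h _] := hf k; exact: h.
by rewrite derive1nS derive1E.
Qed.

Lemma Hinfty_continuous f k : Hinfty f -> continuous (derive1n k f).
Proof. by move=> hf; apply: (@is_derive_continuous _ _ (derive1n k.+1 f)) => x;
  exact: Hinfty_is_derive. Qed.

Lemma continuous_L2_ball w t : continuous_L2 w -> exists2 d : R, 0 < d &
  forall s, `|s - t| < d -> (L2norm (fun x => w s x - w t x)%R < 1%:E)%E.
Proof.
move=> [_ hc].
have : \forall s \near t, (L2norm (fun x => w s x - w t x)%R < 1%:E)%E.
  exact: near_lt_of_cvg0 (hc t) ltr01.
move=> /nbhs_ballP[d /= d0 hd].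
by exists d => // s sd; apply: hd; rewrite /ball/= distrC.
Qed.

Lemma continuous_L2_locally_bounded w t : continuous_L2 w ->
  exists M d : R, [/\ 0 < M, 0 < d & forall s, `|s - t| < d -> (L2norm (w s) <= M%:E)%E].
Proof.
move=> cw; have [d d0 hd] := continuous_L2_ball t cw; have hL := cw.1.
have [M0 hM0] : exists M0 : R, (L2norm (w t) <= M0%:E)%E.
  exists (fine (L2norm (w t))); rewrite fineK// ge0_fin_numE ?L2norm_ge0//.
  exact: L2_lty.
have M1 : 0 < `|M0| + 1 by rewrite ltr_wpDl.
exists (`|M0| + 1), d; split => // s /hd h.
apply: le_trans (L2norm_le_dist (L2_measurable (hL s)) (L2_measurable (hL t))) _.
rewrite [`|M0| + 1]addrC EFinD; apply: leeD; first exact: (ltW h).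
by apply: le_trans hM0 _; rewrite lee_fin ler_norm.
Qed.

(** One neighbourhood of [t] serves the first [n] derivatives simultaneously. *)
Lemma continuous_Hinfty_locally_bounded w t n : continuous_Hinfty w ->
  exists M d : R, [/\ 0 < M, 0 < d & forall s k, `|s - t| < d -> (k < n)%N ->
     (L2norm (derive1n k (w s)) <= M%:E)%E].
Proof.
move=> [_ hc]; elim: n => [|n [M [d [M0 d0 h]]]]; first by exists 1, 1; split.
have [M' [d' [M'0 d'0 h']]] := continuous_L2_locally_bounded t (hc n).
exists (Num.max M M'), (Num.min d d'); split.
- by rewrite lt_max M0.
- by rewrite lt_min d0.
- move=> s k; rewrite lt_min => /andP[sd sd']; rewrite ltnS leq_eqVlt => /predU1P[->|kn].
    by apply: le_trans (h' _ sd') _; rewrite lee_fin le_max lexx orbT.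
  by apply: le_trans (h _ _ sd kn) _; rewrite lee_fin le_max lexx.
Qed.

Lemma Hinfty_sup f k M x : Hinfty f -> 0 < M ->
  (L2norm (derive1n k f) <= M%:E)%E -> (L2norm (derive1n k.+1 f) <= M%:E)%E ->
  `|derive1n k f x| <= 2 * M.
Proof.
move=> hf M0 h1 h2.
have := sup_le_L2norm x (@Hinfty_continuous _ k.+1 hf)
  (fun x => Hinfty_is_derive k x hf) M0 M0 h1 h2; lra.
Qed.

Section momentum.
Variables (delta : R) (w : R -> R -> R).
Hypotheses (d0 : 0 < delta) (hw : smooth_ilw_solution delta w).

(** The equation solved for the time derivative, with the drift term absorbed
    into the convolution with [kappa]. *)
Lemma smooth_ilw_time_derivative t x :
  is_derive t 1 (fun s => w s x)
   ((delta *+ 2)^-1 * kappa_conv delta (derive1n 2 (w t)) x - w t x * derive1n 1 (w t) x).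
Proof.
have [hc pde] := hw; have hf := hc.1 t.
have [dt [l hT E]] := pde t x.
have [M [d [M0 dd0 hM]]] := continuous_Hinfty_locally_bounded t 5 hc.
have tt : `|t - t| < d by rewrite subrr normr0.
have := is_Tdelta_kappa_conv d0 (fun x => Hinfty_is_derive 1 x hf)
  (fun x => Hinfty_is_derive 2 x hf) (hf 1%N).2 (hf 2%N).2
  (fun x => Hinfty_sup x hf M0 (hM t 3%N tt isT) (hM t 4%N tt isT)) hT.
move=> E2; apply: DeriveDef => //.
rewrite -derive1E; move: E E2; rewrite /=; set D := derive1 _ t => E E2.
have -> : D = - (l + delta^-1 * derive1 (w t) x) - w t x * derive1 (w t) x by lra.
by rewrite E2; ring.
Qed.

(** Differentiation under the integral sign is justified by the continuity of
    the solution in [H^oo]: near [t] the L2 norms of finitely many derivatives,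
    hence by Sobolev the sup norms of the lower ones, are bounded. The quadratic
    term is a derivative and is integrated by parts. *)
Lemma smooth_ilw_momentum_derive (phi phi1 : R -> R) (L : R) t :
  (forall x : R, is_derive x 1 phi (phi1 x)) -> continuous phi1 ->
  (forall x, L <= `|x| -> phi x = 0) -> 0 < L ->
  is_derive t 1 (fun s => \int[mu]_(x in `[- L, L]) (w s x * phi x))
   ((delta *+ 2)^-1 * \int[mu]_(x in `[- L, L]) (phi x * kappa_conv delta (derive1n 2 (w t)) x)
    + 1 / 2 * \int[mu]_(x in `[- L, L]) (w t x ^+ 2 * phi1 x)).
Proof.
move=> dp cp1 p0 L0; have cp := is_derive_continuous dp.
have [hc pde] := hw.
have LL : - L <= L by lra.
have [M [d [M0 dd0 hM]]] := continuous_Hinfty_locally_bounded t 5 hc.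
pose Ck := \int[mu]_z (kappa delta z * (z * (1 + z))).
have cw s : continuous (w s) by exact: (Hinfty_continuous (k := 0) (hc.1 s)).
have [Bp hBp] : exists Bp, forall x, `|phi x| <= Bp.
  have cn := continuous_norm cp.
  have [c _ hcc] := @EVT_max R (fun x => `|phi x|) (- L) L LL (continuous_subspaceT cn).
  exists `|phi c| => x; have [xL|xL] := leP L `|x|; first by rewrite p0// normr0.
  by apply: hcc; rewrite in_itv/=; move: xL; rewrite ltr_norml => /andP[h1 h2]; rewrite !ltW.
have Bp0 : 0 <= Bp by apply: le_trans (hBp 0); exact: normr_ge0.
(* a bound of the time derivative of the integrand, uniform near [t] *)
pose G (x : R) : R := ((delta *+ 2)^-1 * (2 * (2 * M) * Ck) + 2 * M * (2 * M)) * Bp.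
have Ck0 : 0 <= Ck by apply: Rintegral_ge0 => z _; exact: kappa_weight_ge0.
have dd2 : 0 < delta *+ 2 by rewrite mulrn_wgt0.
have G0 x : 0 <= G x.
  by rewrite /G mulr_ge0// addr_ge0// ?mulr_ge0// ?invr_ge0 ltW.
pose f s x := w s x * phi x.
have df (s x : R) : is_derive s 1 (f ^~ x) (((delta *+ 2)^-1 * kappa_conv delta (derive1n 2 (w s)) x
     - w s x * derive1n 1 (w s) x) * phi x).
  have h := smooth_ilw_time_derivative s x; rewrite /f.
  by apply: is_derive_eq; rewrite scaler0 add0r /GRing.scale/= mulrC.
have partE s x : partial1of2 f s x = ((delta *+ 2)^-1 * kappa_conv delta (derive1n 2 (w s)) x
     - w s x * derive1n 1 (w s) x) * phi x.
  by rewrite partial1of2E; have [_ ->] := df s x.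
have tI : `]t - d, t + d[%classic t by rewrite /= in_itv/=; lra.
have int_f s : `]t - d, t + d[%classic s -> mu.-integrable `[- L, L] (EFin \o f s).
  by move=> _; apply: continuous_itv_integrable; exact: continuous_mul.
have der_f s x : `]t - d, t + d[%classic s -> `[- L, L]%classic x -> derivable (f ^~ x) s 1.
  by move=> _ _; have [] := df s x.
have iG : mu.-integrable `[- L, L] (EFin \o G).
  by apply: continuous_itv_integrable => x; exact: cst_continuous.
have G_ub s x : `]t - d, t + d[%classic s -> `[- L, L]%classic x -> `|partial1of2 f s x| <= G x.
  rewrite /= in_itv/= => sI _; rewrite partE /G normrM.
  have sd : `|s - t| < d by rewrite ltr_norml; lra.
  have hs := hc.1 s.
  have sup k y : (k < 4)%N -> `|derive1n k (w s) y| <= 2 * M.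
    by move=> k4; apply: Hinfty_sup => //; apply: hM => //; exact: ltnW.
  apply: ler_pM => //; apply: le_trans (ler_normB _ _) _; apply: lerD.
    rewrite normrM ger0_norm ?invr_ge0 ?(ltW dd2)// ler_wpM2l ?invr_ge0 ?(ltW dd2)//.
    apply: kappa_conv_le d0 (fun y => Hinfty_is_derive 2 y hs) (fun y => sup 3%N y isT).
  by rewrite normrM; apply: ler_pM => //; [exact: (sup 0%N)|exact: (sup 1%N)].
have mL : measurable (`[- L, L]%classic : set R) by exact: measurable_itv.
have D1 := @derivable_under_integral _ _ _ mu f _ mL t _ _ tI int_f der_f G G0 iG G_ub.
have D2 := @differentiation_under_integral _ _ _ mu f _ mL t _ _ tI int_f der_f G G0 iG G_ub.
apply: DeriveDef; first exact: D1.
rewrite -derive1E [LHS]D2.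
have hf := hc.1 t.
have tt : `|t - t| < d by rewrite subrr normr0.
have sup3 y : `|derive1n 3 (w t) y| <= 2 * M.
  by apply: Hinfty_sup => //; exact: hM.
have i1 : mu.-integrable `[- L, L] (EFin \o (fun x => phi x * kappa_conv delta (derive1n 2 (w t)) x)).
  apply: integrableS (kappa_conv_pairing_integrable d0 cp p0 (fun y => Hinfty_is_derive 2 y hf) sup3) => //.
have cw1 : continuous (derive1n 1 (w t)) by exact: Hinfty_continuous.
have c2 : continuous (fun x => w t x * derive1n 1 (w t) x * phi x).
  by apply: continuous_mul => //; exact: continuous_mul.
have -> : \int[mu]_(x in `[- L, L]) partial1of2 f t x =
   \int[mu]_(x in `[- L, L]) ((delta *+ 2)^-1 * (phi x * kappa_conv delta (derive1n 2 (w t)) x)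
     - w t x * derive1n 1 (w t) x * phi x).
  by apply: eq_Rintegral => x _; rewrite partE; ring.
rewrite RintegralB//; last 2 first.
- exact: (@integrableZl _ _ _ mu _ mL (delta *+ 2)^-1 _ i1).
- exact: continuous_itv_integrable.
rewrite RintegralZl//; congr (_ + _).
have dw2 (x : R) : is_derive x 1 (fun x => w t x ^+ 2) (2 * (w t x * derive1n 1 (w t) x)).
  have h := Hinfty_is_derive 0 x hf.
  by apply: is_derive_eq; rewrite /GRing.scale/=; ring.
have cd : continuous (fun x => 2 * (w t x * derive1n 1 (w t) x)).
  apply: continuous_mul; first by move=> x; exact: cst_continuous.
  exact: continuous_mul.
have := Rintegral_by_parts LL cd cp1 dw2 dp.
rewrite !p0 ?normrN ?ler_norm// !mulr0 subrr sub0r => ->.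
have -> : \int[mu]_(x in `[- L, L]) (2 * (w t x * derive1n 1 (w t) x) * phi x) =
   2 * \int[mu]_(x in `[- L, L]) (w t x * derive1n 1 (w t) x * phi x).
  rewrite -RintegralZl//; last exact: continuous_itv_integrable.
  by apply: eq_Rintegral => x _; ring.
lra.
Qed.

End momentum.
End SmoothSolution.

(** * The local mass of a smooth solution *)

Section SmoothEstimate.
Context {R : realType}.
Notation mu := (@lebesgue_measure R).
Implicit Types (x y : R).

Lemma is_derive_scale (F f : R -> R) c x : (forall x : R, is_derive x 1 F (f x)) ->
  is_derive x 1 (fun x => F (x / c)) (f (x / c) / c).
Proof.
move=> dF; have dg : is_derive x 1 (fun x : R => x / c) c^-1.
  by apply: is_derive_eq; rewrite scaler0 add0r /GRing.scale/= mulr1.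
have := @is_derive1_comp _ F (fun x : R => x / c) x _ _ (dF (x / c)) dg.
by rewrite mulrC.
Qed.

Section momentum_weight.
Variables (lam L : R).
Hypotheses (lam1 : 1 <= lam) (lamL : lam <= L).

Let lam0 : 0 < lam. Proof. exact: lt_le_trans lam1. Qed.
Let L0 : 0 < L. Proof. exact: lt_le_trans lamL. Qed.

(** Subtracting the step at the larger scale [L] makes the weight compactly
    supported, at the price of a slope [- 1 / L] only. *)
Definition momentum_weight x : R := smooth_step (x / lam) - smooth_step (x / L).
Definition momentum_weight' x : R := quartic_bump (x / lam) / lam - quartic_bump (x / L) / L.
Definition momentum_weight'' x : R :=
  quartic_bump' (x / lam) / lam ^+ 2 - quartic_bump' (x / L) / L ^+ 2.

Lemma is_derive_momentum_weight x : is_derive x 1 momentum_weight (momentum_weight' x).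
Proof.
have h1 := is_derive_scale lam x (@is_derive_smooth_step R).
have h2 := is_derive_scale L x (@is_derive_smooth_step R).
exact: is_deriveB.
Qed.

Lemma is_derive_momentum_weight' x : is_derive x 1 momentum_weight' (momentum_weight'' x).
Proof.
have h1 := is_derive_scale lam x (@is_derive_quartic_bump R).
have h2 := is_derive_scale L x (@is_derive_quartic_bump R).
rewrite /momentum_weight' /momentum_weight''.
apply: is_derive_eq; rewrite !scaler0 !add0r /GRing.scale/=; field.
by rewrite !gt_eqF.
Qed.

Let ge1 c x : 0 < c -> c <= L -> L <= `|x| -> 1 <= `|x / c|.
Proof.
move=> c0 cL h; rewrite normrM normfV (gtr0_norm c0) ler_pdivlMr// mul1r.
exact: le_trans h.
Qed.

Lemma momentum_weight_eq0 x : L <= `|x| -> momentum_weight x = 0.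
Proof.
move=> h; apply/eqP; rewrite subr_eq0; apply/eqP; apply: smooth_step_eq; try exact: ge1.
rewrite mulrACA mulr_ge0//; first by rewrite -expr2 sqr_ge0.
by rewrite mulr_ge0// invr_ge0 ltW.
Qed.

Lemma momentum_weight'_eq0 x : L <= `|x| -> momentum_weight' x = 0.
Proof. by move=> h; rewrite /momentum_weight' !quartic_bump_eq0 ?mul0r ?subrr//;
  exact: ge1. Qed.

Lemma momentum_weight''_eq0 x : L <= `|x| -> momentum_weight'' x = 0.
Proof. by move=> h; rewrite /momentum_weight'' !quartic_bump'_eq0 ?mul0r ?subrr//;
  exact: ge1. Qed.

Let lip c x y : 0 < c ->
  `|quartic_bump' (x / c) / c ^+ 2 - quartic_bump' (y / c) / c ^+ 2| <= 8 / c ^+ 3 * `|x - y|.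
Proof.
move=> c0; rewrite -mulrBl normrM.
have c2 : 0 < (c ^+ 2)^-1 by rewrite invr_gt0 exprn_gt0.
rewrite (gtr0_norm c2) ler_pdivrMr ?exprn_gt0//.
apply: le_trans (quartic_bump'_lip _ _) _.
rewrite -mulrBl normrM normfV (gtr0_norm c0) le_eqVlt; apply/orP; left; apply/eqP.
by field; rewrite gt_eqF.
Qed.

(** Scaling: a third derivative at scale [c] is of size [1 / c^3], and [lam] is
    the smaller of the two scales. *)
Lemma momentum_weight''_lip x y :
  `|momentum_weight'' x - momentum_weight'' y| <= 16 / lam ^+ 3 * `|x - y|.
Proof.
have -> : momentum_weight'' x - momentum_weight'' y = (quartic_bump' (x / lam) / lam ^+ 2 - quartic_bump' (y / lam) / lam ^+ 2)
  - (quartic_bump' (x / L) / L ^+ 2 - quartic_bump' (y / L) / L ^+ 2)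
    by rewrite /momentum_weight''; ring.
apply: le_trans (ler_normB _ _) _.
apply: le_trans (lerD (lip _ _ lam0) (lip _ _ L0)) _.
rewrite -mulrDl ler_wpM2r//.
have : (L ^+ 3)^-1 <= (lam ^+ 3)^-1.
  by rewrite lef_pV2 ?posrE ?exprn_gt0// lerXn2r// nnegrE ltW.
lra.
Qed.

Lemma norm_momentum_weight_le x : `|momentum_weight x| <= 4.
Proof.
apply: le_trans (ler_normB _ _) _.
have := @norm_smooth_step_le R (x / lam); have := @norm_smooth_step_le R (x / L); lra.
Qed.

End momentum_weight.

Lemma lip_continuous (f : R -> R) K : (forall x y, `|f x - f y| <= K * `|x - y|) ->
  continuous f.
Proof.
move=> h x; apply/cvgrPdist_lt => e e0.
have K1 : 0 < `|K| + 1 by rewrite ltr_wpDl.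
near=> y.
apply: le_lt_trans (h _ _) _.
have : `|x - y| < e / (`|K| + 1).
  by near: y; apply: cvgr_dist_lt => //; rewrite divr_gt0.
rewrite ltr_pdivlMr// => h2; have := ler_norm K; have := normr_ge0 (x - y); nra.
Unshelve. all: by end_near. Qed.

(** The derivative of the momentum dominates the local mass at scale [lam],
    while the momentum itself is only of size [sqrt L]; the mean value theorem
    therefore provides a time at which the local mass is small. *)
Lemma smooth_local_mass_le (delta : R) (w : R -> R -> R) (lam L T0 T1 M : R) :
  0 < delta -> smooth_ilw_solution delta w -> 1 <= lam -> lam <= L -> T0 < T1 -> 0 < M ->
  (forall s, T0 <= s <= T1 -> (L2norm (w s) <= M%:E)%E) ->
  exists2 s : R, T0 < s < T1 &
    \int[mu]_(x in `[- (lam / 2), lam / 2]) (w s x ^+ 2) <=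
    4 * lam * (8 * M * Num.sqrt (2 * L) / (T1 - T0) + M ^+ 2 / (2 * L) +
      (delta *+ 2)^-1 * (2 * (16 / lam ^+ 3) * M * Num.sqrt (2 * L) *
        \int[mu]_z (kappa delta z * (z * (1 + z))))).
Proof.
move=> d0 hw lam1 lamL T01 M0 hM.
have lam0 : 0 < lam by exact: lt_le_trans lam1.
have L0 : 0 < L by exact: lt_le_trans lamL.
have L1 : 1 <= L by exact: le_trans lamL.
have hc := hw.1.
pose phi := momentum_weight lam L; pose phi1 := momentum_weight' lam L;
  pose phi2 := momentum_weight'' lam L.
have dp x : is_derive x 1 phi (phi1 x) by exact: is_derive_momentum_weight.
have dp1 x : is_derive x 1 phi1 (phi2 x) by exact: is_derive_momentum_weight'.
have lp2 x y : `|phi2 x - phi2 y| <= 16 / lam ^+ 3 * `|x - y| by exact: momentum_weight''_lip.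
have cp2 := lip_continuous lp2.
have cp1 := is_derive_continuous dp1; have cp := is_derive_continuous dp.
have p0 x : L <= `|x| -> phi x = 0 by exact: momentum_weight_eq0.
have p10 x : L <= `|x| -> phi1 x = 0 by exact: momentum_weight'_eq0.
have p20 x : L <= `|x| -> phi2 x = 0 by exact: momentum_weight''_eq0.
have LL : - L < L by lra.
pose J s := \int[mu]_(x in `[- L, L]) (w s x * phi x).
pose J' s := (delta *+ 2)^-1 * \int[mu]_(x in `[- L, L]) (phi x * kappa_conv delta (derive1n 2 (w s)) x)
    + 1 / 2 * \int[mu]_(x in `[- L, L]) (w s x ^+ 2 * phi1 x).
have dJ (s : R) : is_derive s 1 J (J' s) by exact: smooth_ilw_momentum_derive.
have cw s : continuous (w s) by exact: (Hinfty_continuous (k := 0) (hc.1 s)).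
have hJ s : T0 <= s <= T1 -> `|J s| <= 4 * M * Num.sqrt (2 * L).
  move=> hs; have cn := continuous_norm (cw s).
  apply: le_trans (normr_Rintegral_itv _ _ _) _; first exact: continuous_mul.
  apply: (@le_trans _ _ (\int[mu]_(x in `[- L, L]) (4 * `|w s x|))).
    apply: le_Rintegral_itv.
    - by apply: continuous_norm; exact: continuous_mul.
    - by apply: continuous_mul => // x; exact: cst_continuous.
    - by move=> x _; rewrite normrM mulrC ler_wpM2r// norm_momentum_weight_le.
  rewrite RintegralZl//; last exact: continuous_itv_integrable.
  have := Rintegral_norm_le_L2norm (cw s) LL M0 (hM s hs).
  by rewrite (_ : L - - L = 2 * L); [lra|ring].
have [s sT E] := @MVT R J J' T0 T1 T01 (fun x _ => dJ x)
  (continuous_subspaceT (is_derive_continuous dJ)).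
have {}sT : T0 < s < T1 by move: sT; rewrite in_itv/=.
exists s => //.
have sT' : T0 <= s <= T1 by lra.
have J'le : J' s <= 8 * M * Num.sqrt (2 * L) / (T1 - T0).
  rewrite ler_pdivlMr ?subr_gt0// -E.
  have := hJ T0 ltac:(lra); have := hJ T1 ltac:(lra); rewrite !ler_norml; lra.
have [Md [d [Md0 dd0 hMd]]] := continuous_Hinfty_locally_bounded s 5 hc.
have ss : `|s - s| < d by rewrite subrr normr0.
have hf := hc.1 s.
have sup3 y : `|derive1n 3 (w s) y| <= 2 * Md.
  by apply: Hinfty_sup => //; exact: hMd.
have disp := kappa_conv_pairing_le d0 dp dp1 lp2 p0 p10 p20 L1 cp2
  (fun x => Hinfty_is_derive 0 x hf) (fun x => Hinfty_is_derive 1 x hf)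
  (fun x => Hinfty_is_derive 2 x hf) sup3 M0 (hM s sT').
set Q := 2 * (16 / lam ^+ 3) * M * Num.sqrt (2 * L) * _ in disp *.
have dd2 : 0 < (delta *+ 2)^-1 by rewrite invr_gt0 mulrn_wgt0.
have disp2 : - ((delta *+ 2)^-1 * Q) <= (delta *+ 2)^-1 *
   \int[mu]_(x in `[- L, L]) (phi x * kappa_conv delta (derive1n 2 (w s)) x).
  by rewrite -mulrN ler_wpM2l ?(ltW dd2)//; move: disp; rewrite ler_norml => /andP[].
have cw2 := continuous_sqr (cw s).
have sc c : continuous (fun x : R => quartic_bump (x / c) / c).
  have h := is_derive_continuous (fun x => is_derive_scale c x (@is_derive_quartic_bump R)).
  by apply: continuous_mul => // x; exact: cst_continuous.
have cA : continuous (fun x => w s x ^+ 2 * (quartic_bump (x / lam) / lam))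
  by exact: continuous_mul.
have cB : continuous (fun x => w s x ^+ 2 * (quartic_bump (x / L) / L))
  by exact: continuous_mul.
have phiE : \int[mu]_(x in `[- L, L]) (w s x ^+ 2 * phi1 x) =
   \int[mu]_(x in `[- L, L]) (w s x ^+ 2 * (quartic_bump (x / lam) / lam)) -
   \int[mu]_(x in `[- L, L]) (w s x ^+ 2 * (quartic_bump (x / L) / L)).
  rewrite -RintegralB//; [|exact: continuous_itv_integrable..].
  by apply: eq_Rintegral => x _; rewrite /phi1 /momentum_weight' mulrBr.
have upper : \int[mu]_(x in `[- L, L]) (w s x ^+ 2 * (quartic_bump (x / L) / L)) <= M ^+ 2 / L.
  apply: (@le_trans _ _ (\int[mu]_(x in `[- L, L]) (L^-1 * w s x ^+ 2))).
    apply: le_Rintegral_itv => //.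
      by apply: continuous_mul => // x; exact: cst_continuous.
    move=> x _; rewrite mulrC ler_wpM2r ?sqr_ge0// ler_pdivrMr// mulVf ?gt_eqF//.
    exact: quartic_bump_le1.
  rewrite RintegralZl//; last exact: continuous_itv_integrable.
  rewrite mulrC ler_wpM2r ?invr_ge0 ?(ltW L0)//.
  exact: (L2norm_itv_sqr _ _ (cw s) (ltW M0) (hM s sT')).
set m := \int[mu]_(x in `[- (lam / 2), lam / 2]) _.
have lower : m / (2 * lam) <= \int[mu]_(x in `[- L, L]) (w s x ^+ 2 * (quartic_bump (x / lam) / lam)).
  apply: (@le_trans _ _ (\int[mu]_(x in `[- (lam / 2), lam / 2]) (w s x ^+ 2 * (quartic_bump (x / lam) / lam)))).
    rewrite /m mulrC -RintegralZl//; last exact: continuous_itv_integrable.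
    apply: le_Rintegral_itv => //.
      by apply: continuous_mul => // x; exact: cst_continuous.
    move=> x hx; rewrite mulrC ler_wpM2l ?sqr_ge0// ler_pdivlMr//.
    have -> : (2 * lam)^-1 * lam = 1 / 2 by field; rewrite gt_eqF.
    apply: quartic_bump_ge_half; rewrite normrM normfV (gtr0_norm lam0) ler_pdivrMr//.
    by rewrite ler_norml; move: hx; clear -lam0 => hx; lra.
  apply: le_Rintegral_itv_subset => //; [|by clear -lam0 lamL; lra..].
  by move=> x; rewrite mulr_ge0 ?sqr_ge0// divr_ge0 ?quartic_bump_ge0// ltW.
have main : m / (4 * lam) <= 8 * M * Num.sqrt (2 * L) / (T1 - T0) + M ^+ 2 / (2 * L) +
    (delta *+ 2)^-1 * Q.
  have -> : m / (4 * lam) = 1 / 2 * (m / (2 * lam)) by field; rewrite gt_eqF.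
  have -> : M ^+ 2 / (2 * L) = 1 / 2 * (M ^+ 2 / L) by field; rewrite gt_eqF.
  move: J'le disp2 upper lower; rewrite /J' phiE -/m.
  move: (_ * \int[mu]_(x in `[- L, L]) (phi x * _)) => X.
  move: (\int[mu]_(x in `[- L, L]) (_ * (quartic_bump (_ / lam) / lam))) => Y.
  move: (\int[mu]_(x in `[- L, L]) (_ * (quartic_bump (_ / L) / L))) => Z.
  move: (m / _) (M ^+ 2 / _) (_ * Q) (8 * _ * _ / _) => a1 a2 a3 a4.
  by clear; lra.
by move: main; rewrite ler_pdivrMr ?mulr_gt0// mulrC.
Qed.

End SmoothEstimate.

(** * Sigmoids and functions of class H^oo *)

Section HinftyAlgebra.
Context {R : realType}.
Notation mu := (@lebesgue_measure R).
Implicit Types (f g : R -> R) (x a b c n : R).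

Lemma L2_add f g : L2 f -> L2 g -> L2 (fun x => f x + g x).
Proof.
move=> hf hg; apply: L2P.
  by apply: measurable_funD; exact: L2_measurable.
apply: le_lt_trans (L2norm_triangle (L2_measurable hf) (L2_measurable hg)) _.
by apply: lte_add_pinfty; exact: L2_lty.
Qed.

Lemma L2_scale c f : L2 f -> L2 (fun x => c * f x).
Proof.
move=> hf; have := @Lfun_scale _ _ R mu f c 2 ltac:(by rewrite ler1n) hf.
rewrite /L2 (_ : (fun x => c * f x) = c \o* f)//.
by apply/funext => x /=; rewrite mulrC.
Qed.

Lemma L2_sqr_integrable f : measurable_fun setT f ->
  mu.-integrable setT (EFin \o (fun x => f x ^+ 2)) -> L2 f.
Proof.
move=> mf hf; apply: L2P => //.
have h0 : (0 <= \int[mu]_x (f x ^+ 2)%:E)%E by apply: integral_ge0 => x _;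
  rewrite lee_fin sqr_ge0.
have hfin := integrable_fin_num measurableT hf.
have [M M0 hM] : exists2 M : R, 0 <= M & (\int[mu]_x (f x ^+ 2)%:E <= (M ^+ 2)%:E)%E.
  exists (Num.sqrt (fine (\int[mu]_x (f x ^+ 2)%:E)%E)); first exact: sqrtr_ge0.
  by rewrite sqr_sqrtr ?fine_ge0// fineK.
by apply: le_lt_trans ((L2norm_leP _ M0).2 hM) _; exact: ltry.
Qed.

(** Exhibiting a family of functions that is stable under differentiation avoids
    computing iterated derivatives in closed form. *)
Lemma Hinfty_of_closed (A : (R -> R) -> Prop) f :
  (forall g, A g -> L2 g /\ exists2 g', A g' & forall x : R, is_derive x 1 g (g' x)) ->
  A f -> Hinfty f.
Proof.
move=> hA Af.
have AD k : A (derive1n k f).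
  elim: k => [//|k IH]; have [_ [g' Ag' dg]] := hA _ IH.
  rewrite derive1nS (_ : derive1 (derive1n k f) = g')//.
  by apply/funext => x; rewrite derive1E; have [_ ->] := dg x.
move=> k; have [h [g' _ dg]] := hA _ (AD k).
by split => // x; have [] := dg x.
Qed.

Lemma Hinfty_lin c f g : Hinfty f -> Hinfty g -> Hinfty (fun x => f x + c * g x).
Proof.
move=> hf hg.
apply: (@Hinfty_of_closed (fun h => exists k, h = fun x => derive1n k f x + c * derive1n k g x)).
  move=> _ [k ->]; split.
    by apply: L2_add; [exact: (hf k).2|apply: L2_scale; exact: (hg k).2].
  exists (fun x => derive1n k.+1 f x + c * derive1n k.+1 g x); first by exists k.+1.
  move=> x; have h1 := Hinfty_is_derive k x hf; have h2 := Hinfty_is_derive k x hg.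
  exact: is_deriveD.
by exists 0%N.
Qed.

Definition sigmoid x : R := (1 + expR (- x))^-1.

Lemma sigmoid_gt0 x : 0 < sigmoid x.
Proof. by rewrite invr_gt0 addr_gt0// expR_gt0. Qed.

Lemma sigmoid_lt1 x : sigmoid x < 1.
Proof. by rewrite invf_lt1 ?addr_gt0 ?expR_gt0// ltrDl expR_gt0. Qed.

Lemma sigmoidN x : sigmoid (- x) = 1 - sigmoid x.
Proof.
rewrite /sigmoid opprK expRN; have := expR_gt0 x; set e := expR x => e0.
by field; rewrite !gt_eqF// addr_gt0.
Qed.

Lemma sigmoid_le x : sigmoid x <= expR x.
Proof.
rewrite /sigmoid expRN; have := expR_gt0 x; set e := expR x => e0.
have -> : (1 + e^-1)^-1 = e * (e + 1)^-1 by field; rewrite !gt_eqF// addr_gt0.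
by rewrite ler_piMr ?(ltW e0)// invf_le1 ?addr_gt0// lerDr ltW.
Qed.

Lemma is_derive_sigmoid x : is_derive x 1 sigmoid (sigmoid x * (1 - sigmoid x)).
Proof.
have p : 1 + expR (- x) != 0 by rewrite gt_eqF// addr_gt0// expR_gt0.
have dN : is_derive x 1 (fun x : R => - x) (- 1) by apply: is_derive_eq.
have de : is_derive x 1 (fun x : R => expR (- x)) (- expR (- x)).
  have := @is_derive1_comp R expR (fun x : R => - x) x _ _ (is_derive_expR _) dN.
  by rewrite mulrN1.
have d1 : is_derive x 1 (fun x : R => 1 + expR (- x)) (- expR (- x)).
  have h := is_deriveD (is_derive_cst (1 : R) x 1) de.
  by rewrite add0r in h.
have := @is_deriveV R (fun y => 1 + expR (- y)) x _ 1 p d1; rewrite /sigmoid => h.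
apply: (is_derive_eq h).
by rewrite /GRing.scale/=; field.
Qed.

Lemma sigmoid_decay n a x : 1 <= n -> sigmoid (n * (x - a)) <= Num.min 1 (expR (x - a)).
Proof.
move=> n1; rewrite le_min (ltW (sigmoid_lt1 _))/=.
have [xa|ax] := leP x a; last first.
  apply: (@le_trans _ _ 1); first exact: ltW (sigmoid_lt1 _).
  by rewrite -expR0 ler_expR subr_ge0 ltW.
apply: le_trans (sigmoid_le _) _; rewrite ler_expR.
nra.
Qed.

End HinftyAlgebra.

Section SigmoidDensity.
Context {R : realType}.
Notation mu := (@lebesgue_measure R).
Implicit Types (f g : R -> R) (x a b c n : R).

Lemma ge0_integral_opp (f : R -> \bar R) : measurable_fun setT f ->
  (forall x, 0 <= f x)%E -> (\int[mu]_x f (- x)%R = \int[mu]_x f x)%E.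
Proof.
move=> mf f0.
have mN : measurable_fun setT (-%R : measurableTypeR R -> measurableTypeR R).
  by apply: continuous_measurable_fun; exact: opp_continuous.
transitivity (\int[mu]_(x in (-%R : measurableTypeR R ->
  measurableTypeR R) @^-1` setT) (f \o -%R) x)%E.
  by rewrite preimage_setT.
rewrite -(ge0_integral_pushforward mN)//.
by apply: eq_measure_integral => A mA _; exact: lebesgue_measureN.
Qed.

(** An integrable majorant of [e^(- |x|)], assembled from two densities of the
    exponential law. *)
Definition exp_tail x : R := exponential_pdf 1 x + exponential_pdf 1 (- x).

Lemma exp_tail_ge x : expR (- `|x|) <= exp_tail x.
Proof.
rewrite /exp_tail; have [x0|x0] := leP 0 x.
  rewrite ger0_norm// exponential_pdfE// mul1r mulN1r lerDl.
  exact: exponential_pdf_ge0.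
rewrite ltr0_norm// opprK addrC exponential_pdfE; last by rewrite oppr_ge0 ltW.
by rewrite mul1r mulN1r opprK lerDl exponential_pdf_ge0.
Qed.

Lemma exp_tail_integrable : mu.-integrable setT (EFin \o exp_tail).
Proof.
have i1 := @integrable_exponential_pdf R 1 ltr01.
have m1 := measurable_exponential_pdf (1 : R).
have m2 : measurable_fun setT (fun x => exponential_pdf 1 (- x)).
  exact: (measurableT_comp m1).
have i2 : mu.-integrable setT (EFin \o (fun x => exponential_pdf 1 (- x))).
  apply/integrableP; split; first exact/measurable_EFinP.
  have <- : (\int[mu]_x (exponential_pdf 1 (- x))%:E =
      \int[mu]_x `|(EFin \o (fun x => exponential_pdf 1 (- x)%R)) x|)%E.
    by apply: eq_integral => x _; rewrite /= ger0_norm// exponential_pdf_ge0.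
  have -> := @ge0_integral_opp (fun y => (exponential_pdf 1 y)%:E).
  - by rewrite integral_exponential_pdf// ltry.
  - exact/measurable_EFinP.
  - by move=> x; rewrite lee_fin exponential_pdf_ge0.
have := integrableD measurableT i1 i2.
by apply: eq_integrable => // x _; rewrite /= /exp_tail EFinD.
Qed.

Lemma L2_of_decay f C : measurable_fun setT f ->
  (forall x, `|f x| <= C * expR (- `|x|)) -> L2 f.
Proof.
move=> mf hf; apply: L2_sqr_integrable => //.
have iC := integrableZl measurableT (C ^+ 2) exp_tail_integrable.
apply: (le_integrable measurableT _ _ iC).
  by apply/measurable_EFinP; exact: measurable_funX.
move=> x _; rewrite lee_fin; apply: le_trans (ler_norm _).
rewrite ger0_norm ?sqr_ge0// -real_normK ?num_real//.
have C0 : 0 <= C.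
  have := hf 0; rewrite normr0 oppr0 expR0 mulr1; apply: le_trans; exact: normr_ge0.
have e0 := expR_ge0 (- `|x|).
have e1 : expR (- `|x|) <= 1 by rewrite -expR0 ler_expR oppr_le0.
apply: (@le_trans _ _ ((C * expR (- `|x|)) ^+ 2)).
  by rewrite ler_sqr ?nnegrE ?mulr_ge0.
rewrite exprMn ler_wpM2l ?sqr_ge0//.
apply: le_trans (exp_tail_ge x); nra.
Qed.

Definition scaled_sigmoid n a x : R := sigmoid (n * (x - a)).

Lemma is_derive_scaled_sigmoid n a x :
  is_derive x 1 (scaled_sigmoid n a) (n * (scaled_sigmoid n a x * (1 - scaled_sigmoid n a x))).
Proof.
have dg : is_derive x 1 (fun x : R => n * (x - a)) n.
  by apply: is_derive_eq; rewrite oppr0 addr0 /GRing.scale/= mulr1.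
have := @is_derive1_comp _ (@sigmoid R) (fun x : R => n * (x - a)) x _ _ (is_derive_sigmoid _) dg.
by rewrite mulrC.
Qed.

Lemma scaled_sigmoid_01 n a x : 0 < scaled_sigmoid n a x < 1.
Proof. by rewrite sigmoid_gt0 sigmoid_lt1. Qed.

Lemma scaled_sigmoid_le n a x : 1 <= n -> scaled_sigmoid n a x <= expR (x - a).
Proof. by move=> n1; have := sigmoid_decay a x n1; rewrite le_min => /andP[]. Qed.

Lemma scaled_sigmoid_ge n a x : 1 <= n -> 1 - scaled_sigmoid n a x <= expR (a - x).
Proof.
move=> n1; rewrite /scaled_sigmoid -sigmoidN.
have := @scaled_sigmoid_le n (- a) (- x) n1; rewrite /scaled_sigmoid.
by rewrite (_ : n * (- x - - a) = - (n * (x - a))) 1?(_ : - x - - a = a - x)//; ring.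
Qed.

(** Polynomials in the sigmoid that vanish at 0 and 1: a family closed under
    differentiation because the sigmoid solves [s' = n s (1 - s)]. *)
Definition sigmoid_poly n a (p : {poly R}) x : R :=
  scaled_sigmoid n a x * (1 - scaled_sigmoid n a x) * p.[scaled_sigmoid n a x].

Lemma is_derive_sigmoid_poly n a p x :
  is_derive x 1 (sigmoid_poly n a p) (sigmoid_poly n a (n *: ('X * (1 - 'X) * p)^`()) x).
Proof.
set Q := 'X * (1 - 'X) * p.
have dQ : is_derive (scaled_sigmoid n a x) 1 (horner Q) (Q^`()).[scaled_sigmoid n a x]
  by exact: is_derive_poly.
have := @is_derive1_comp _ (horner Q) (scaled_sigmoid n a) x _ _ dQ (is_derive_scaled_sigmoid n a x).
have -> : horner Q \o scaled_sigmoid n a = sigmoid_poly n a p.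
  by apply/funext => y; rewrite /= /sigmoid_poly /Q !hornerE.
by move=> h; apply: (is_derive_eq h); rewrite /sigmoid_poly hornerZ; ring.
Qed.

(** The single constant [|a| + |b|] serves both half lines. *)
Lemma decay_min (y a b x : R) : y <= expR (x - a) -> y <= expR (b - x) ->
  y <= expR (`|a| + `|b|) * expR (- `|x|).
Proof.
move=> h1 h2; rewrite -expRD; have [x0|x0] := leP 0 x.
  apply: le_trans h2 _; rewrite ler_expR (ger0_norm x0).
  have := ler_norm b; have := normr_ge0 a; lra.
apply: le_trans h1 _; rewrite ler_expR (ltr0_norm x0).
have := ler_norm (- a); rewrite normrN; have := normr_ge0 b; lra.
Qed.

Lemma sigmoid_poly_L2 n a p : 1 <= n -> L2 (sigmoid_poly n a p).
Proof.
move=> n1.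
have cs : continuous (sigmoid_poly n a p).
  by apply: (@is_derive_continuous _ _ (sigmoid_poly n a (n *: ('X * (1 - 'X) * p)^`()))) => x;
    exact: is_derive_sigmoid_poly.
have [C hC] : exists C, forall t, 0 <= t <= 1 -> `|p.[t]| <= C.
  have cp := continuous_norm (@continuous_horner R p).
  have [c _ hc] := @EVT_max R (fun t => `|p.[t]|) 0 1 ler01 (continuous_subspaceT cp).
  by exists `|p.[c]| => t ht; apply: hc; rewrite in_itv.
apply: (@L2_of_decay _ (expR (`|a| + `|a|) * C)).
  exact: continuous_measurable_fun.
move=> x; rewrite /sigmoid_poly; have /andP[s0 s1] := scaled_sigmoid_01 n a x.
have s10 : 0 < 1 - scaled_sigmoid n a x by rewrite subr_gt0.
rewrite normrM ger0_norm; last by rewrite mulr_ge0// ltW.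
rewrite [X in _ <= X]mulrAC; apply: ler_pM => //; first by rewrite mulr_ge0// ltW.
  apply: decay_min.
    by apply: le_trans (scaled_sigmoid_le a x n1); rewrite ler_piMr ?(ltW s0)//; lra.
  by apply: le_trans (scaled_sigmoid_ge a x n1); rewrite ler_piMl ?(ltW s10)//; lra.
by apply: hC; rewrite !ltW.
Qed.

Lemma sigmoid_poly_Hinfty n a p : 1 <= n -> Hinfty (sigmoid_poly n a p).
Proof.
move=> n1; apply: (@Hinfty_of_closed _ (fun h => exists q, h = sigmoid_poly n a q));
  last by exists p.
move=> _ [q ->]; split; first exact: sigmoid_poly_L2.
exists (sigmoid_poly n a (n *: ('X * (1 - 'X) * q)^`())); first by eexists.
by move=> x; exact: is_derive_sigmoid_poly.
Qed.

Lemma Hinfty_of_derive f f' : L2 f -> (forall x : R, is_derive x 1 f (f' x)) ->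
  Hinfty f' -> Hinfty f.
Proof.
move=> Lf df hf'.
apply: (@Hinfty_of_closed _ (fun h => h = f \/ exists k, h = derive1n k f')); last by left.
move=> _ [->|[k ->]]; split => //.
- by exists f' => //; right; exists 0%N.
- exact: (hf' k).2.
- exists (derive1n k.+1 f'); first by right; exists k.+1.
  by move=> x; exact: Hinfty_is_derive.
Qed.

(** A smooth version of the indicator of [a, b[, sharper as [n] grows. *)
Definition sigmoid_box n a b x : R := scaled_sigmoid n a x - scaled_sigmoid n b x.

(** The majorant does not depend on [n], so that it can be used for dominated
    convergence as [n] tends to infinity. *)
Lemma sigmoid_box_decay n a b x : 1 <= n -> a <= b ->
  0 <= sigmoid_box n a b x <= expR (`|a| + `|b|) * expR (- `|x|).
Proof.
move=> n1 ab; have /andP[s0 s1] := scaled_sigmoid_01 n a x;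
  have /andP[t0 t1] := scaled_sigmoid_01 n b x.
apply/andP; split.
  rewrite subr_ge0 /scaled_sigmoid /sigmoid lef_pV2 ?posrE ?addr_gt0 ?expR_gt0//.
  by rewrite lerD2l ler_expR lerN2 ler_pM2l; lra.
apply: decay_min.
  by apply: le_trans (scaled_sigmoid_le a x n1); rewrite /sigmoid_box; lra.
by apply: le_trans (scaled_sigmoid_ge b x n1); rewrite /sigmoid_box; lra.
Qed.

Lemma sigmoid_box_measurable n a b : measurable_fun setT (sigmoid_box n a b).
Proof.
apply: continuous_measurable_fun.
have c c' : continuous (scaled_sigmoid n c').
  by apply: (@is_derive_continuous _ _ (fun x => n * (scaled_sigmoid n c' x * (1 - scaled_sigmoid n c' x)))) => x; exact: is_derive_scaled_sigmoid.
by move=> x; apply: cvgB; exact: c.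
Qed.

Lemma sigmoid_box_Hinfty n a b : 1 <= n -> a <= b -> Hinfty (sigmoid_box n a b).
Proof.
move=> n1 ab.
apply: (@Hinfty_of_derive _ (fun x => n * sigmoid_poly n a 1 x + (- n) * sigmoid_poly n b 1 x)).
- apply: (@L2_of_decay _ (expR (`|a| + `|b|))); first exact: sigmoid_box_measurable.
  by move=> x; have /andP[h1 h2] := sigmoid_box_decay x n1 ab; rewrite ger0_norm.
- move=> x; have h1 := is_derive_scaled_sigmoid n a x;
  have h2 := is_derive_scaled_sigmoid n b x.
  have h := is_deriveB h1 h2; apply: (is_derive_eq h).
  by rewrite /sigmoid_poly !hornerC; ring.
- apply: Hinfty_lin; last exact: sigmoid_poly_Hinfty.
  have -> : (fun x => n * sigmoid_poly n a 1 x) =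
      (fun x => sigmoid_poly n a 1 x + (n - 1) * sigmoid_poly n a 1 x)
        by apply/funext => x; ring.
  by apply: Hinfty_lin; exact: sigmoid_poly_Hinfty.
Qed.

End SigmoidDensity.

(** * Density of H^oo in L2 *)

Section IndicatorApproximation.
Context {R : realType}.
Notation mu := (@lebesgue_measure R).
Implicit Types (f g h s v : R -> R) (x a b c e : R).

(** Membership in the L2 closure of [H^oo], which is a linear subspace closed
    under L2 limits. *)
Definition smooth_approximable f := L2 f /\
  forall e, 0 < e -> exists2 v, Hinfty v & (L2norm (fun x => v x - f x)%R <= e%:E)%E.

Lemma Hinfty_L2 v : Hinfty v -> L2 v.
Proof. by move=> hv; exact: (hv 0%N).2. Qed.

Lemma L2norm_scale_le c f M : measurable_fun setT f -> 0 <= M ->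
  (L2norm f <= M%:E)%E -> (L2norm (fun x => c * f x)%R <= (`|c| * M)%:E)%E.
Proof.
move=> mf M0 hM; apply/L2norm_leP; first by rewrite mulr_ge0.
have -> : (\int[mu]_x ((c * f x) ^+ 2)%:E = (c ^+ 2)%:E * \int[mu]_x (f x ^+ 2)%:E)%E.
  rewrite -ge0_integralZl//.
  - by apply: eq_integral => x _; rewrite exprMn EFinM.
  - by apply/measurable_EFinP; exact: measurable_funX.
  - by move=> x _; rewrite lee_fin sqr_ge0.
  - by rewrite lee_fin sqr_ge0.
rewrite exprMn real_normK ?num_real// (EFinM (c ^+ 2) (M ^+ 2)).
by apply: lee_wpmul2l; [rewrite lee_fin sqr_ge0|exact/L2norm_leP].
Qed.

Lemma smooth_approximable_lim f : L2 f ->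
  (forall e, 0 < e -> exists2 g, smooth_approximable g & (L2norm (fun x => g x - f x)%R <= e%:E)%E) ->
  smooth_approximable f.
Proof.
move=> Lf H; split=> // e e0; have e2 : 0 < e / 2 by rewrite divr_gt0.
have [g [Lg hg] gf] := H _ e2; have [v hv vg] := hg _ e2.
exists v => //.
apply: le_trans (L2norm_triangleB (L2_measurable (Hinfty_L2 hv)) (L2_measurable Lg) (L2_measurable Lf)) _.
by rewrite (splitr e) EFinD; exact: leeD.
Qed.

Lemma smooth_approximable_lin c f g : smooth_approximable f -> smooth_approximable g ->
  smooth_approximable (fun x => f x + c * g x).
Proof.
move=> [Lf hf] [Lg hg]; split; first by apply: L2_add => //; exact: L2_scale.
move=> e e0; have e2 : 0 < e / 2 by rewrite divr_gt0.
have c1 : 0 < `|c| + 1 by rewrite ltr_wpDl.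
have ec : 0 < e / 2 / (`|c| + 1) by rewrite divr_gt0.
have [v hv vf] := hf _ e2; have [w hw wg] := hg _ ec.
have [mf mg] := (L2_measurable Lf, L2_measurable Lg).
have [mv mw] := (L2_measurable (Hinfty_L2 hv), L2_measurable (Hinfty_L2 hw)).
exists (fun x => v x + c * w x); first exact: Hinfty_lin.
have -> : (fun x => v x + c * w x - (f x + c * g x)) =
   (fun x => (v x - f x) + c * (w x - g x)) by apply/funext => x; ring.
have m1 : measurable_fun setT (fun x => w x - g x) by exact: measurable_funB.
apply: le_trans (L2norm_triangle _ _) _.
- exact: measurable_funB.
- exact: measurable_funM.
rewrite (splitr e) EFinD; apply: leeD => //.
apply: le_trans (L2norm_scale_le c m1 (ltW ec) wg) _.
rewrite lee_fin mulrCA ler_piMr ?(ltW e2)// ler_pdivrMr// mul1r.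
by rewrite lerDl.
Qed.

Lemma L2norm_le_itv f a b eta : measurable_fun setT f -> a <= b -> 0 <= eta ->
  (forall x, a <= x <= b -> `|f x| <= eta) -> (forall x, ~~ (a <= x <= b) -> f x = 0) ->
  (L2norm f <= (eta * Num.sqrt (b - a))%:E)%E.
Proof.
move=> mf ab eta0 h1 h2; apply/L2norm_leP; first by rewrite mulr_ge0 ?sqrtr_ge0.
have ba : 0 <= b - a by rewrite subr_ge0.
rewrite exprMn sqr_sqrtr//.
have -> : (\int[mu]_x (f x ^+ 2)%:E = \int[mu]_(x in `[a, b]) (f x ^+ 2)%:E)%E.
  rewrite [RHS]integral_mkcond; apply: eq_integral => x _; rewrite patchE.
  case: ifPn => //; rewrite notin_setE/= in_itv/= => /negP h.
  by rewrite h2// expr0n.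
have := @Rintegral_itv_cst R a b (eta ^+ 2) ab => <-.
have ic : mu.-integrable `[a, b] (EFin \o (fun _ : R => eta ^+ 2)).
  by apply: continuous_itv_integrable => x; exact: cst_continuous.
rewrite /Rintegral fineK; last exact: integrable_fin_num ic.
apply: ge0_le_integral => //.
- by move=> x _; rewrite lee_fin sqr_ge0.
- by apply/measurable_EFinP; apply: measurable_funX; exact: measurable_funTS.
- move=> x /=; rewrite in_itv/= => hx; rewrite lee_fin -real_normK ?num_real//.
  by rewrite ler_sqr ?nnegrE// h1.
Qed.

Definition indic_co a b x : R := if a <= x < b then 1 else 0.

Lemma measurable_indic_co a b : measurable_fun setT (indic_co a b).
Proof.
apply: measurable_fun_ifT => //; apply: measurable_and.
  exact: measurable_fun_ler.
exact: measurable_fun_ltr.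
Qed.

Lemma indic_co_L2 a b : a <= b -> L2 (indic_co a b).
Proof.
move=> ab; apply: L2P; first exact: measurable_indic_co.
apply: (@le_lt_trans _ _ (1 * Num.sqrt (b - a))%:E); last exact: ltry.
apply: L2norm_le_itv => //; first exact: measurable_indic_co.
  by move=> x _; rewrite /indic_co; case: ifPn => _; rewrite ?normr1// normr0.
by move=> x; rewrite /indic_co; case: ifPn => // /andP[h1 h2]; rewrite h1 (ltW h2).
Qed.

(** It suffices to treat [x < a], where [e^(-u) >= 1 - u] is enough; the
    symmetry [s(- x) = 1 - s(x)] gives the other side. *)
Lemma scaled_sigmoid_cvg a x : x != a ->
  scaled_sigmoid (k.+1%:R : R) a x @[k --> \oo] --> (if a < x then 1 else 0 : R).
Proof.
move=> xa.
have noo : (k.+1%:R : R) @[k --> \oo] --> +oo.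
  by apply/cvgryPge => A; have /cvgryPge/(_ A) := @cvgr_idn R;
    apply: filterS => k /le_trans; apply; rewrite ler_nat.
have low y : y < a -> scaled_sigmoid (k.+1%:R : R) a y @[k --> \oo] --> (0 : R).
  move=> ya; apply/cvgr0Pnorm_le => e e0.
  have /cvgryPge/(_ (e^-1 / (a - y))) := noo; apply: filterS => k hk.
  have d0 : 0 < a - y by rewrite subr_gt0.
  have /andP[s0 _] := scaled_sigmoid_01 k.+1%:R a y; rewrite (gtr0_norm s0).
  rewrite /scaled_sigmoid; set u := k.+1%:R * (y - a).
  have hu : e^-1 <= - u by move: hk; rewrite ler_pdivrMr// /u -mulrN opprB.
  rewrite /sigmoid invf_ple ?posrE ?addr_gt0 ?expR_gt0//.
  by apply: le_trans hu _; have := expR_ge1Dx (- u); lra.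
have [ax|] := ltP a x; last first.
  by rewrite le_eqVlt (negPf xa)/= => xa'; exact: low.
rewrite /=; have := low (a - (x - a)) ltac:(lra).
have E k : scaled_sigmoid (k.+1%:R : R) a x = 1 - scaled_sigmoid (k.+1%:R : R) a (a - (x - a)).
  rewrite /scaled_sigmoid -sigmoidN; congr sigmoid; ring.
move=> h; rewrite (_ : (fun k => _) = (fun k => 1 - scaled_sigmoid (k.+1%:R : R) a (a - (x - a)))); last exact/funext.
suff : (fun k => 1 - scaled_sigmoid (k.+1%:R : R) a (a - (x - a))) @ \oo --> (1 - 0 : R).
  by rewrite subr0.
by apply: cvgB => //; exact: cvg_cst.
Qed.

Lemma L2norm_cvg0_ex (F : nat -> R -> R) :
  (\int[mu]_x ((F k x) ^+ 2)%:E @[k --> \oo] --> 0)%E ->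
  forall e, 0 < e -> exists k, (L2norm (F k) <= e%:E)%E.
Proof.
move=> H e e0.
have : \forall k \near \oo, (\int[mu]_x ((F k x) ^+ 2)%:E < (e ^+ 2)%:E)%E.
  by apply: near_lt_of_cvg0 => //; rewrite exprn_gt0.
move=> [k _ /(_ k (leqnn k))] /= hk.
exists k.
by apply/L2norm_leP; [exact: ltW|exact: ltW].
Qed.

(** Dominated convergence of steep sigmoid boxes, which converge to the
    indicator at all points other than the two endpoints. *)
Lemma smooth_approximable_indic_co a b : a <= b -> smooth_approximable (indic_co a b).
Proof.
move=> ab; split; first exact: indic_co_L2.
pose C := expR (`|a| + `|b|).
pose g k : R -> R := sigmoid_box k.+1%:R a b.
have g1 k : 1 <= k.+1%:R :> R by rewrite ler1n.
have C1 : 0 <= C by exact: expR_ge0.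
have boxC x : 0 <= indic_co a b x <= C * expR (- `|x|).
  rewrite /indic_co; case: ifPn => [/andP[h1 h2]|_]; last by rewrite lexx mulr_ge0 ?expR_ge0.
  rewrite ler01/=; apply: decay_min; rewrite -expR0 ler_expR; lra.
have mg k : measurable_fun setT (fun x => g k x - indic_co a b x).
  by apply: measurable_funB; [exact: sigmoid_box_measurable|exact: measurable_indic_co].
have it := integrableZl measurableT (C ^+ 2) (@exp_tail_integrable R).
have H : (\int[mu]_x ((g k x - indic_co a b x) ^+ 2)%:E @[k --> \oo] --> \int[mu]_x (cst 0 x))%E.
  have := @dominated_convergence _ _ _ mu setT measurableT
    (fun k x => ((g k x - indic_co a b x) ^+ 2)%:E) (cst 0%E)
    (fun x => (C ^+ 2)%:E * (exp_tail x)%:E)%E.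
  case => //.
  - by move=> k; apply/measurable_EFinP; apply: measurable_funX; exact: mg.
  - exists ([set a] `|` [set b]); split.
    + by apply: measurableU => //; apply: measurable_set1.
    + by apply: null_set_setU;
      [exact: measurable_set1|exact: measurable_set1|exact: lebesgue_measure_set1|exact: lebesgue_measure_set1].
    + move=> x /= nx; apply: contrapT => xab; apply: nx => _.
      have xa : x != a by apply/eqP => xa; apply: xab; left.
      have xb : x != b by apply/eqP => xb; apply: xab; right.
      have lim : g k x - indic_co a b x @[k --> \oo] --> (0 : R).
        have -> : (0 : R) = (if a < x then 1 else 0) - (if b < x then 1 else 0) - indic_co a b x.
          rewrite /indic_co; case: (ltgtP a x) xa => // ax _;
            case: (ltgtP b x) xb => // bx _ /=;
            rewrite ?subr0 ?subrr ?subr0//.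
          by exfalso; move: ax bx ab; clear; lra.
        apply: cvgB; last exact: cvg_cst.
        by apply: cvgB; exact: scaled_sigmoid_cvg.
      apply: cvg_EFin; first exact: nearW.
      suff : (fun k => (g k x - indic_co a b x) * (g k x - indic_co a b x)) @ \oo --> (0 * 0 : R).
        by rewrite mulr0.
      by apply: cvgM.
  - apply/aeW => x k _; rewrite lee_fin ger0_norm ?sqr_ge0//.
    have /andP[b0 b1] := boxC x; have /andP[s0 s1] := sigmoid_box_decay x (g1 k) ab.
    have e0 := expR_ge0 (- `|x|).
    have e1 : expR (- `|x|) <= 1 by rewrite -expR0 ler_expR oppr_le0.
    have : (g k x - indic_co a b x) ^+ 2 <= (C * expR (- `|x|)) ^+ 2.
      rewrite -[X in X <= _]real_normK ?num_real// ler_sqr ?nnegrE ?mulr_ge0//.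
      by rewrite ler_norml /g; rewrite -/C in s1; lra.
    move=> h; apply: le_trans h _; rewrite exprMn ler_wpM2l ?sqr_ge0//.
    by apply: le_trans (exp_tail_ge x); nra.
rewrite integral0 in H.
move=> e e0; have [k hk] := L2norm_cvg0_ex H e0.
by exists (g k) => //; exact: sigmoid_box_Hinfty.
Qed.

End IndicatorApproximation.

Section DensityL2.
Context {R : realType}.
Notation mu := (@lebesgue_measure R).
Implicit Types (f g h s v : R -> R) (x a b c e eta : R).

(** The step functions are built from left to right; by continuity, the supremum
    of the right endpoints that can be reached is itself reached and, if it is
    less than [b], passed. *)
Lemma step_approx h a b eta : continuous h -> a <= b -> 0 < eta ->
  exists s, [/\ smooth_approximable s, forall x, a <= x < b -> `|h x - s x| <= eta &
    forall x, ~~ (a <= x < b) -> s x = 0].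
Proof.
move=> ch ab eta0.
pose P c := a <= c <= b /\ exists s, [/\ smooth_approximable s,
  forall x, a <= x < c -> `|h x - s x| <= eta & forall x, ~~ (a <= x < c) -> s x = 0].
have Pa : P a.
  split; first by rewrite lexx.
  exists (indic_co a a); split; first exact: smooth_approximable_indic_co.
  - by move=> x; lra.
  - by move=> x; rewrite /indic_co; case: ifPn => // ; lra.
have supP : has_sup [set c | P c].
  by split; [exists a|exists b => c [/andP[]]].
set c := sup [set c | P c].
have ac : a <= c by apply: ub_le_sup => //; exact: supP.2.
have cb : c <= b by apply: ge_sup => [|y [/andP[]]//]; exists a.
(* by continuity a step function that stops short of [c] by less than [d] can
   be prolonged past [c] with the value [h c] *)
have [d d0 hd] : exists2 d, 0 < d & forall x, `|x - c| < d -> `|h x - h c| <= eta.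
  have /cvgrPdist_le/(_ _ eta0) := ch c; move=> /nbhs_ballP[d /= d0 hd].
  by exists d => // x xd; rewrite distrC; apply: hd; rewrite /ball/= distrC.
have ext c' : c <= c' -> c' < c + d -> c' <= b -> P c'.
  move=> cc' c'd c'b.
  have [c0 [/andP[ac0 c0b] [s [As s1 s2]]] c0c] := sup_adherent d0 supP.
  rewrite -/c in c0c.
  have c0c1 : c0 <= c by apply: ub_le_sup; [exact: supP.2|split; [rewrite ac0|exists s]].
  split; first by rewrite (le_trans ac cc').
  have c0c' : c0 <= c' by exact: le_trans cc'.
  exists (fun x => s x + h c * indic_co c0 c' x); split.
  - by apply: smooth_approximable_lin => //; exact: smooth_approximable_indic_co.
  - move=> x /andP[ax xc']; have [xc0|c0x] := ltP x c0.
      rewrite /indic_co [X in if X then _ else _]ifF; last by rewrite leNgt xc0.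
      by rewrite mulr0 addr0 s1// ax.
    rewrite /indic_co c0x xc' mulr1 s2 ?add0r; last by rewrite ltNge c0x andbF.
    by apply: hd; rewrite ltr_norml; lra.
  - move=> x nx; rewrite s2; last by apply: contra nx => /andP[-> h2]; rewrite (lt_le_trans h2).
    rewrite /indic_co ifF ?mulr0 ?addr0//.
    by apply: contraNF nx => /andP[h1 ->]; rewrite (le_trans ac0).
have Pc : P c by apply: ext => //; lra.
have [cb'|bc] := ltP c b; last by have -> : b = c by [lra]; case: Pc.
pose c' := Num.min b (c + d / 2).
have : P c'.
  apply: ext; rewrite /c'.
  - by rewrite le_min cb lerDl divr_ge0// ltW.
  - by rewrite gt_min; apply/orP; right; rewrite ltrD2l ltr_pdivrMr// ltr_pMr// ltr1n.
  - by rewrite ge_min lexx.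
move=> Pc'; have : c' <= c by apply: ub_le_sup => //; exact: supP.2.
by rewrite leNgt lt_min cb' ltrDl divr_gt0.
Qed.

Lemma smooth_approximable_continuous h a b : continuous h -> a <= b ->
  smooth_approximable (fun x => h x * indic_co a b x).
Proof.
move=> ch ab.
have mhb : measurable_fun setT (fun x => h x * indic_co a b x).
  by apply: measurable_funM; [exact: continuous_measurable_fun|exact: measurable_indic_co].
have key eta : 0 < eta -> exists2 s, smooth_approximable s &
    (L2norm (fun x => s x - h x * indic_co a b x)%R <= (eta * Num.sqrt (b - a))%:E)%E.
  move=> eta0; have [s [As s1 s2]] := step_approx ch ab eta0.
  exists s => //; apply: L2norm_le_itv => //.
  - by apply: measurable_funB => //; exact: L2_measurable As.1.
  - exact: ltW.
  - move=> x _; rewrite /indic_co; case: ifPn => hx.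
      by rewrite mulr1 distrC s1.
    by rewrite s2// mulr0 subrr normr0 ltW.
  - move=> x nx; have nx' : ~~ (a <= x < b).
      by apply: contra nx => /andP[-> h2]; rewrite ltW.
    by rewrite s2// /indic_co (negPf nx') mulr0 subrr.
have Lhb : L2 (fun x => h x * indic_co a b x).
  have [s [Ls _] hs] := key 1 ltr01.
  apply: L2P => //.
  apply: le_lt_trans (L2norm_le_dist mhb (L2_measurable Ls)) _.
  apply: lte_add_pinfty; last exact: L2_lty.
  by rewrite L2normBC; apply: le_lt_trans hs _; exact: ltry.
apply: smooth_approximable_lim => // e e0.
pose eta := e / (Num.sqrt (b - a) + 1).
have s1 : 0 < Num.sqrt (b - a) + 1 by rewrite ltr_wpDl ?sqrtr_ge0.
have [s As hs] := key eta ltac:(by rewrite divr_gt0).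
exists s => //; apply: le_trans hs _; rewrite lee_fin /eta mulrAC ler_pdivrMr//.
by rewrite ler_wpM2l ?(ltW e0)// lerDl.
Qed.

(** Bounded functions with bounded support are L1 limits of continuous
    functions. After truncation at the bound [N], L1-close implies L2-close,
    since the square of a difference bounded by [2 N] is at most [2 N] times the
    difference. *)
Lemma smooth_approximable_bounded f N : measurable_fun setT f -> 0 < N ->
  (forall x, `|f x| <= N) -> (forall x, ~~ (- N <= x < N) -> f x = 0) -> smooth_approximable f.
Proof.
move=> mf N0 fN f0.
have NN : - N <= N by lra.
have Lf : L2 f.
  apply: L2P => //; apply: (@le_lt_trans _ _ (N * Num.sqrt (N - - N))%:E); last exact: ltry.
  apply: L2norm_le_itv => //; first exact: ltW.
  by move=> x nx; apply: f0; apply: contra nx => /andP[-> h2]; rewrite ltW.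
apply: smooth_approximable_lim => // e e0.
pose E := `[- N, N]%classic : set R.
have mE : measurable E by exact: measurable_itv.
have muE : (mu E < +oo)%E.
  by rewrite /E lebesgue_measure_itv/=; case: ifP => _; rewrite ?ltry// ltry.
have iC : mu.-integrable E (EFin \o (fun _ : R => N)).
  by apply: continuous_itv_integrable => x; exact: cst_continuous.
have iF : mu.-integrable E (EFin \o f).
  apply: (le_integrable _ _ _ iC); first exact: measurable_itv.
    by apply/measurable_EFinP; exact: measurable_funTS.
  by move=> x _; rewrite lee_fin (ger0_norm (ltW N0)).
have [g_ [cg ig lim]] := approximation_continuous_integrable mE muE iF.
have e2 : 0 < e ^+ 2 / (2 * N) by rewrite divr_gt0 ?exprn_gt0 ?mulr_gt0.
have : \forall k \near \oo, (\int[mu]_(z in E) `|(f z - g_ k z)%:E| < (e ^+ 2 / (2 * N))%:E)%E.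
  exact: near_lt_of_cvg0.
move=> [k _ /(_ k (leqnn k))] /=; set g := g_ k => hg.
(* truncating [g] at the bound of [f] cannot increase its distance to [f] *)
pose h x := N * clamp (g x / N).
have ch : continuous h.
  have cc : continuous (@clamp R).
    by apply: (@lip_continuous _ _ 1) => x y; rewrite mul1r; exact: clamp_lip.
  have cgN : continuous (fun x => g x / N).
    by apply: continuous_mul; [exact: cg|move=> x; exact: cst_continuous].
  apply: continuous_mul; first by move=> x; exact: cst_continuous.
  exact: (continuous_compose cgN cc).
have hfg x : (h x - f x) ^+ 2 <= 2 * N * `|f x - g x|.
  have hN : `|h x| <= N.
    rewrite /h normrM (gtr0_norm N0) ler_piMr ?(ltW N0)// ler_norml.
    exact: clamp_bounds.
  have d1 : `|h x - f x| <= 2 * N.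
    by apply: le_trans (ler_normB _ _) _; have := fN x; lra.
  have d2 : `|h x - f x| <= `|f x - g x|.
    have fE : clamp (f x / N) = f x / N.
      apply: clamp_id; have := fN x; rewrite ler_norml => /andP[h1 h2].
      by rewrite ler_pdivlMr// ler_pdivrMr// mulN1r mul1r h1.
    have -> : h x - f x = N * (clamp (g x / N) - clamp (f x / N)).
      by rewrite fE /h; field; rewrite gt_eqF.
    have -> : `|f x - g x| = N * `|g x / N - f x / N|.
      rewrite -mulrBl normrM normfV (gtr0_norm N0) distrC.
      by field; rewrite gt_eqF.
    by rewrite normrM (gtr0_norm N0) ler_wpM2l ?(ltW N0)// clamp_lip.
  have n0 := normr_ge0 (h x - f x).
  rewrite -real_normK ?num_real// expr2.
  by apply: ler_pM.
have mhf : measurable_fun setT (fun x => h x * indic_co (- N) N x - f x).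
  apply: measurable_funB => //; apply: measurable_funM; last exact: measurable_indic_co.
  exact: continuous_measurable_fun.
exists (fun x => h x * indic_co (- N) N x); first exact: smooth_approximable_continuous.
apply/L2norm_leP; first exact: ltW.
apply: (@le_trans _ _ (\int[mu]_(z in E) ((2 * N)%:E * `|(f z - g z)%:E|))%E).
  rewrite [leRHS]integral_mkcond; apply: ge0_le_integral => //.
  - by move=> x _; rewrite lee_fin sqr_ge0.
  - by apply/measurable_EFinP; exact: measurable_funX.
  - apply/(measurable_restrictT _ _).1 => //; apply: measurable_funeM.
    apply: measurableT_comp => //; apply/measurable_EFinP; apply: measurable_funB.
      exact: measurable_funTS.
    by apply: measurable_funTS; apply: continuous_measurable_fun; exact: cg.
  - move=> x _; rewrite patchE /indic_co; have [hx|hx] := boolP (- N <= x < N).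
      rewrite ifT; last by move/andP: hx => [h1 h2]; rewrite inE /E /= in_itv/= h1 ltW.
      by rewrite mulr1 /= -EFinM lee_fin.
    rewrite mulr0 sub0r f0// oppr0 expr0n/=; case: ifPn => _ //.
    by rewrite /= -EFinM lee_fin mulr_ge0// mulr_ge0// ltW.
rewrite ge0_integralZl//; last 2 first.
- apply: measurableT_comp => //; apply/measurable_EFinP; apply: measurable_funB.
    exact: measurable_funTS.
  by apply: measurable_funTS; apply: continuous_measurable_fun; exact: cg.
- by rewrite lee_fin mulr_ge0// ltW.
have -> : (e ^+ 2)%:E = ((2 * N)%:E * (e ^+ 2 / (2 * N))%:E)%E.
  by rewrite -EFinM; congr EFin; field; rewrite gt_eqF.
by apply: lee_wpmul2l; [rewrite lee_fin mulr_ge0// ltW|exact: ltW].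
Qed.

(** Truncation of both the values and the support, and dominated convergence. *)
Lemma smooth_approximable_L2 f : L2 f -> smooth_approximable f.
Proof.
move=> Lf; have mf := L2_measurable Lf.
apply: smooth_approximable_lim => // e e0.
pose F (k : nat) x : R := if (- k.+1%:R <= x < k.+1%:R) && (`|f x| <= k.+1%:R) then f x else 0.
have mF k : measurable_fun setT (F k).
  apply: measurable_fun_ifT => //; apply: measurable_and.
    apply: measurable_and; first exact: measurable_fun_ler.
    exact: measurable_fun_ltr.
  by apply: measurable_fun_ler => //; exact: measurableT_comp.
have iff : mu.-integrable setT (EFin \o (fun x => f x ^+ 2)) by exact: Lfun2_integrable_sqr.
have H : (\int[mu]_x ((F k x - f x) ^+ 2)%:E @[k --> \oo] --> \int[mu]_x (cst 0 x))%E.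
  have := @dominated_convergence _ _ _ mu setT measurableT
    (fun k x => ((F k x - f x) ^+ 2)%:E) (cst 0%E) (EFin \o (fun x => f x ^+ 2)).
  case => //.
  - by move=> k; apply/measurable_EFinP; apply: measurable_funX;
    exact: (measurable_funB (mF k) mf).
  - apply/aeW => x _; apply: cvg_near_cst.
    have /cvgryPge/(_ (`|x| + `|f x| + 1)) := @cvgr_idn R.
    apply: filterS => k hk.
    have k1 : `|x| + `|f x| + 1 < k.+1%:R.
      by apply: le_lt_trans hk _; rewrite ltr_nat.
    have x0 := normr_ge0 x; have y0 := normr_ge0 (f x).
    have : `|x| < k.+1%:R by lra.
    rewrite ltr_norml => /andP[h1 h2].
    by rewrite /F (ltW h1) h2/= ifT ?subrr ?expr0n//; lra.
  - apply/aeW => x k _; rewrite lee_fin ger0_norm ?sqr_ge0// /F.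
    by case: ifPn => _; rewrite ?subrr ?expr0n ?sqr_ge0// sub0r sqrrN.
rewrite integral0 in H.
have [k hk] := L2norm_cvg0_ex H e0.
exists (F k) => //; apply: (@smooth_approximable_bounded _ k.+1%:R) => //.
- by move=> x; rewrite /F; case: ifPn => [/andP[]//|_]; rewrite normr0.
- by move=> x nx; rewrite /F (negPf nx).
Qed.

Theorem Hinfty_dense_L2 f e : L2 f -> 0 < e ->
  exists2 v, Hinfty v & (L2norm (fun x => v x - f x)%R < e%:E)%E.
Proof.
move=> Lf e0; have [_ H] := smooth_approximable_L2 Lf.
have [v hv vf] := H (e / 2) ltac:(by rewrite divr_gt0).
exists v => //; apply: le_lt_trans vf _; rewrite lte_fin.
by rewrite ltr_pdivrMr// ltr_pMr// ltr1n.
Qed.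

End DensityL2.

(** * Decay of the local mass of an L2 solution *)

Section LocalMassDecay.
Context {R : realType}.
Notation mu := (@lebesgue_measure R).
Implicit Types (u w : R -> R -> R) (T s M b c : R).

(** The choice [L ~ T^(2/3)] balances [sqrt L / T] against [1 / L], and
    [lam ~ T^b] with [1/2 <= b] keeps the dispersive term [sqrt L / lam^3] below
    them. *)
Lemma smooth_decay (delta M b : R) : 0 < delta -> 0 < M -> 1 / 2 <= b -> b < 2 / 3 ->
  exists2 C, 0 < C & forall w T, smooth_ilw_solution delta w -> 1 <= T ->
    (forall s, T <= s <= 2 * T -> (L2norm (w s) <= M%:E)%E) ->
    exists2 s, T < s < 2 * T &
      \int[mu]_(x in `[- ((2 * T) `^ b), (2 * T) `^ b]) (w s x ^+ 2) <=
        C * T `^ (- (2 / 3 - b)).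
Proof.
move=> d0 M0 b1 b2.
pose Ck := \int[mu]_z (kappa delta z * (z * (1 + z))).
have Ck0 : 0 <= Ck by apply: Rintegral_ge0 => z _; exact: kappa_weight_ge0.
pose K := (delta *+ 2)^-1 * (96 * M * Ck).
have K0 : 0 <= K.
  by rewrite mulr_ge0 ?invr_ge0 ?mulrn_wge0 ?(ltW d0)// mulr_ge0// mulr_ge0// ltW.
exists (16 * (24 * M + M ^+ 2 / 8) + K + 1).
  by rewrite ltr_wpDl// addr_ge0// mulr_ge0// addr_ge0 ?mulr_ge0 ?divr_ge0 ?sqr_ge0// ltW.
move=> w T hw T1 hM.
have T0 : 0 < T by exact: lt_le_trans T1.
(* in terms of [x] and [y] all the powers of [T] below have integer exponents *)
set y := T `^ b; set x := T `^ (1 / 3).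
have x0 : 0 < x by rewrite powR_gt0.
have y0 : 0 < y by rewrite powR_gt0.
have pow_ge1 a c : 1 <= a -> 0 <= c -> 1 <= a `^ c.
  by move=> a1 c0; have := ler_powR a1 c0; rewrite powRr0.
have x1 : 1 <= x by apply: pow_ge1.
have x3 : x ^+ 3 = T.
  by rewrite -powR_mulrn ?(ltW x0)// -powRrM (_ : 1 / 3 * 3%:R = 1) ?powRr1 ?(ltW T0)//; field.
have x2 : x ^+ 2 = T `^ (2 / 3).
  by rewrite -powR_mulrn ?(ltW x0)// -powRrM; congr powR; field.
have yT : T <= y ^+ 2.
  rewrite -powR_mulrn ?(ltW y0)// -powRrM -{1}(powRr1 (ltW T0)).
  by apply: ler_powR => //; lra.
have y1 : 1 <= y by apply: pow_ge1 => //; lra.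
have yx : y <= x ^+ 2 by rewrite x2; apply: ler_powR => //; exact: ltW.
set r := (2 * T) `^ b.
have rE : r = 2 `^ b * y by rewrite /r powRM// ltW.
have p1 : 1 <= 2 `^ b by apply: pow_ge1; lra.
have p2 : 2 `^ b <= 2 by rewrite -[leRHS]powRr1//; apply: ler_powR; lra.
(* the factor 2 because the estimate reaches only [|x| <= lam / 2], the factor
   4 to have [lam <= L] *)
pose lam := 2 * r; pose L := 4 * x ^+ 2.
have ry : y <= r by rewrite rE ler_peMl// ltW.
have ry2 : r <= 2 * y by rewrite rE ler_wpM2r// ltW.
have lam1 : 1 <= lam by rewrite /lam; lra.
have lamL : lam <= L by rewrite /lam /L; lra.
have TT : T < 2 * T by lra.
have [s sT hs] := smooth_local_mass_le d0 hw lam1 lamL TT M0 hM.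
exists s => //; move: hs; rewrite (_ : lam / 2 = r); last by rewrite /lam; field.
move=> /le_trans; apply.
have -> : T `^ (- (2 / 3 - b)) = y / x ^+ 2.
  rewrite (_ : - (2 / 3 - b) = b - 2 / 3); last by ring.
  by rewrite powRB ?x2//; apply/implyP => _; rewrite gt_eqF.
have sq : Num.sqrt (2 * L) <= 3 * x.
  have x30 : 0 <= 3 * x by rewrite mulr_ge0// ltW.
  rewrite -[leRHS](ger0_norm x30) -sqrtr_sqr ler_wsqrtr// /L; have := sqr_ge0 x; lra.
have sq0 := sqrtr_ge0 (2 * L); set q := Num.sqrt (2 * L) in sq sq0 *.
have lam0 : 0 < lam by exact: lt_le_trans lam1.
have t1 : 4 * lam * (8 * M * q / (2 * T - T)) <= 16 * (24 * M) * (y / x ^+ 2).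
  rewrite (_ : 2 * T - T = x ^+ 3); last by rewrite x3; ring.
  have -> : 16 * (24 * M) * (y / x ^+ 2) = 16 * y * (8 * M * (3 * x) / x ^+ 3).
    by field; rewrite gt_eqF.
  apply: ler_pM.
  - by rewrite mulr_ge0// ltW.
  - by rewrite divr_ge0 ?mulr_ge0 ?exprn_ge0// ltW.
  - by rewrite /lam; lra.
  - by rewrite ler_wpM2r ?invr_ge0 ?exprn_ge0 ?(ltW x0)// ler_wpM2l// mulr_ge0// ltW.
have t2 : 4 * lam * (M ^+ 2 / (2 * L)) <= 16 * (M ^+ 2 / 8) * (y / x ^+ 2).
  have -> : 16 * (M ^+ 2 / 8) * (y / x ^+ 2) = 16 * y * (M ^+ 2 / (2 * L)).
    by rewrite /L; field; rewrite gt_eqF.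
  rewrite ler_wpM2r ?divr_ge0 ?sqr_ge0 ?mulr_ge0 ?sqr_ge0// /lam; lra.
have t3 : 4 * lam * ((delta *+ 2)^-1 * (2 * (16 / lam ^+ 3) * M * q * Ck)) <= K * (y / x ^+ 2).
  have -> : 4 * lam * ((delta *+ 2)^-1 * (2 * (16 / lam ^+ 3) * M * q * Ck)) =
    ((delta *+ 2)^-1 * (32 * M * Ck)) * (q * (4 / lam ^+ 2)).
    by rewrite -mulr_natr; field; rewrite !gt_eqF.
  have -> : K * (y / x ^+ 2) = ((delta *+ 2)^-1 * (32 * M * Ck)) * (3 * x * (y / x ^+ 3)).
    by rewrite /K -mulr_natr; field; rewrite !gt_eqF.
  rewrite ler_wpM2l//.
    by rewrite mulr_ge0 ?invr_ge0 ?mulrn_wge0 ?(ltW d0)// mulr_ge0// mulr_ge0// ltW.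
  apply: ler_pM => //; first by rewrite divr_ge0// sqr_ge0.
  rewrite ler_pdivrMr ?exprn_gt0// mulrAC ler_pdivlMr ?exprn_gt0// x3.
  have l2 : 4 * y ^+ 2 <= lam ^+ 2 by rewrite /lam; nra.
  have : 4 * T <= lam ^+ 2 by lra.
  have := sqr_ge0 lam; nra.
rewrite !(mulrDr (4 * lam)); apply: le_trans (lerD (lerD t1 t2) t3) _.
have p0 : 0 <= y / x ^+ 2 by rewrite divr_ge0 ?sqr_ge0// ltW.
rewrite [leRHS](_ : _ = 16 * (24 * M) * (y / x ^+ 2) + 16 * (M ^+ 2 / 8) * (y / x ^+ 2)
  + K * (y / x ^+ 2) + y / x ^+ 2); last by ring.
by rewrite lerDl.
Qed.

(** A null set contains no interval. *)
Lemma ae_dense_ball (P : R -> Prop) t d : 0 < d -> {ae mu, forall s, P s} ->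
  exists2 s, `|s - t| < d & P s.
Proof.
move=> d0 [A [mA A0 hA]]; apply: contrapT => nP.
have sub : `]t - d, t + d[ `<=` A.
  move=> s /=; rewrite in_itv/= => hs; apply: hA => /= Ps; apply: nP.
  by exists s => //; rewrite ltr_norml; lra.
have : (mu `](t - d)%R, (t + d)%R[ <= mu A)%E.
  by apply: le_measure => //; rewrite inE//; exact: measurable_itv.
rewrite A0 lebesgue_measure_itv/= lte_fin ifT; last lra.
by rewrite leNgt -EFinB lte_fin => /negP; apply; lra.
Qed.

(** By continuity in time, a bound at almost every time holds at every time, up
    to an arbitrary loss; here the loss is 1. *)
Lemma bounded_L2_everywhere u : continuous_L2 u -> bounded_L2 u ->
  exists2 M : R, 0 < M & forall t, (L2norm (u t) <= M%:E)%E.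
Proof.
move=> cu [M hM]; exists (`|M| + 1); first by rewrite ltr_wpDl.
move=> t; have [d d0 hd] := continuous_L2_ball t cu; have Lu := cu.1.
have [s /hd h hs] := ae_dense_ball t d0 hM.
apply: le_trans (L2norm_le_dist (L2_measurable (Lu t)) (L2_measurable (Lu s))) _.
rewrite L2normBC [`|M| + 1]addrC EFinD; apply: leeD; first exact: (ltW h).
by apply: le_trans hs _; rewrite lee_fin ler_norm.
Qed.

(** The data are approximated in L2 by [H^oo] data, for which the flow gives
    smooth solutions; the continuity of the flow does the rest. *)
Lemma ilw_solution_smooth_approx (delta : R) (u0 : R -> R) u T (e : R) : L2 u0 ->
  ilw_solution delta u0 u ->
  continuous_L2 u -> 0 < T -> 0 < e ->
  exists2 w, smooth_ilw_solution delta w &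
    forall t, - T <= t <= T -> (L2norm (fun x => w t x - u t x)%R <= e%:E)%E.
Proof.
move=> Lu0 [_ [S [Ssmooth SL2 Scont] uS]] [Lu _] T0 e0.
have [d d0 hd] := Scont T T0 u0 Lu0 e e0.
have [v hv vd] := Hinfty_dense_L2 Lu0 d0.
have [w [sw _ wS]] := Ssmooth v hv; exists w => // t tT.
have Lv := Hinfty_L2 hv.
have := hd v Lv vd t tT; congr (_ <= _)%E.
have mS v' : L2 v' -> measurable_fun setT (S v' t).
  by move=> Lv'; apply: L2_measurable; exact: (SL2 v' Lv').1.
have mw : measurable_fun setT (w t) by exact: (L2_measurable (Hinfty_L2 (sw.1.1 t))).
apply: ae_eq_L2norm.
- by apply: measurable_funB; exact: mS.
- by apply: measurable_funB => //; exact: L2_measurable (Lu t).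
- by apply: ae_eq_sub; [exact: wS|apply: ae_eq_sym; exact: uS].
Qed.

Lemma sqr_le_double (a c : R) : a ^+ 2 <= 2 * c ^+ 2 + 2 * (c - a) ^+ 2.
Proof. by have := sqr_ge0 (2 * c - a); nra. Qed.

(** The smooth estimate is applied to a smooth solution at distance
    [e = T^(- c/2)] of [u] on [T, 2 T]: both contributions to the local mass of
    [u] are then of size [T^(- c)]. Replacing [b] by [max(b, 1/2)] only enlarges
    the ball. *)
Lemma local_mass_decay (delta : R) (u0 : R -> R) u b : 0 < delta -> L2 u0 ->
  ilw_solution delta u0 u ->
  continuous_L2 u -> bounded_L2 u -> 0 < b -> b < 2 / 3 ->
  exists C c : R, [/\ 0 < C, 0 < c & forall T, 1 <= T ->
    exists2 s, T < s < 2 * T & (local_mass u (s `^ b) s <= (C * T `^ (- c))%:E)%E].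
Proof.
move=> d0 Lu0 hu cu bu b0 b2.
have [M M0 hM] := bounded_L2_everywhere cu bu.
pose b' := Num.max b (1 / 2).
have bb' : b <= b' by rewrite le_max lexx.
have b'1 : 1 / 2 <= b' by rewrite le_max lexx orbT.
have b'2 : b' < 2 / 3 by rewrite gt_max b2/=; lra.
have M1 : 0 < M + 1 by lra.
have [C C0 hC] := smooth_decay d0 M1 b'1 b'2.
pose c := 2 / 3 - b'; have c0 : 0 < c by rewrite /c; lra.
exists (2 * C + 2), c; split => //; first lra.
move=> T T1; have T0 : 0 < T by exact: lt_le_trans T1.
pose e := T `^ (- (c / 2)).
have e0 : 0 < e by rewrite powR_gt0.
have e2 : e ^+ 2 = T `^ (- c).
  by rewrite -powR_mulrn ?(ltW e0)// -powRrM; congr powR; field.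
have e1 : e <= 1.
  have := @ler_powR _ T T1 (- (c / 2)) 0; rewrite powRr0; apply; lra.
have T2 : 0 < 2 * T by lra.
have [w sw hw] := ilw_solution_smooth_approx Lu0 hu cu T2 e0.
have mu_ t : measurable_fun setT (u t) by apply: L2_measurable; exact: cu.1.
have mw t : measurable_fun setT (w t) by exact: (L2_measurable (Hinfty_L2 (sw.1.1 t))).
have hMw s : T <= s <= 2 * T -> (L2norm (w s) <= (M + 1)%:E)%E.
  move=> hs; have h1 := hw s ltac:(lra).
  apply: le_trans (L2norm_le_dist (mw s) (mu_ s)) _.
  rewrite [M + 1]addrC EFinD; apply: leeD => //.
  by apply: le_trans h1 _; rewrite lee_fin.
have [s sT hs] := hC w T sw T1 hMw.
exists s => //.
have hws := hw s ltac:(lra).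
have cw : continuous (w s) by exact: (Hinfty_continuous (k := 0) (sw.1.1 s)).
set r := (2 * T) `^ b' in hs.
have mD : measurable_fun setT (fun x => w s x - u s x) by exact: measurable_funB.
have m1 : measurable_fun setT (EFin \o (fun x => w s x ^+ 2)).
  by apply/measurable_EFinP; exact: measurable_funX.
have m2 : measurable_fun setT (EFin \o (fun x => (w s x - u s x) ^+ 2)).
  by apply/measurable_EFinP; exact: measurable_funX.
have sr : s `^ b <= r.
  apply: (@le_trans _ _ ((2 * T) `^ b)).
    by apply: ge0_ler_powR; rewrite ?nnegrE ?ltW//; lra.
  by apply: ler_powR => //; lra.
have mB : measurable [set x : R | `|x| < s `^ b].
  rewrite (_ : [set x | _] = `]- (s `^ b), s `^ b[%classic); first exact: measurable_itv.
  by apply/seteqP; split => x /=; rewrite in_itv/= ltr_norml.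
have i1 : mu.-integrable `[- r, r] (EFin \o (fun x => w s x ^+ 2)).
  by apply: continuous_itv_integrable; exact: continuous_sqr.
rewrite /local_mass.
apply: (@le_trans _ _ (\int[mu]_(x in [set x | (`|x| < s `^ b)%R])
   (2%:E * (w s x ^+ 2)%:E + 2%:E * ((w s x - u s x) ^+ 2)%:E))%E).
  apply: ge0_le_integral => //.
  - by move=> x _; rewrite lee_fin sqr_ge0.
  - by apply/measurable_EFinP; apply: measurable_funX; exact: (measurable_funTS (mu_ s)).
  - by apply: emeasurable_funD; apply: measurable_funeM;
    [exact: (measurable_funTS m1)|exact: (measurable_funTS m2)].
  - by move=> x _; rewrite -!EFinM -EFinD lee_fin; exact: sqr_le_double.
rewrite ge0_integralD//; last 4 first.
- by move=> x _; rewrite -EFinM lee_fin mulr_ge0// sqr_ge0.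
- by apply: measurable_funeM; exact: (measurable_funTS m1).
- by move=> x _; rewrite -EFinM lee_fin mulr_ge0// sqr_ge0.
- by apply: measurable_funeM; exact: (measurable_funTS m2).
rewrite !ge0_integralZl//; last 4 first.
- exact: (measurable_funTS m2).
- by move=> x _; rewrite lee_fin sqr_ge0.
- exact: (measurable_funTS m1).
- by move=> x _; rewrite lee_fin sqr_ge0.
rewrite (_ : (_ * T `^ _)%:E = (2%:E * (C * T `^ (- c))%:E + 2%:E * (T `^ (- c))%:E)%E);
  last first.
  by rewrite -!EFinM -EFinD; congr EFin; ring.
apply: leeD.
- apply: lee_wpmul2l => //.
  apply: (@le_trans _ _ (\int[mu]_(x in `[(- r)%R, r]) (w s x ^+ 2)%:E)%E).
    apply: ge0_subset_integral => //.
    + exact: (measurable_funTS m1).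
    + by move=> x _; rewrite lee_fin sqr_ge0.
    + by move=> x /=; rewrite in_itv/= ltr_norml => /andP[h1 h2]; lra.
  move: hs; rewrite -lee_fin /Rintegral fineK//; exact: integrable_fin_num i1.
- apply: lee_wpmul2l => //.
  apply: (@le_trans _ _ (\int[mu]_x ((w s x - u s x) ^+ 2)%:E)%E).
    apply: ge0_subset_integral => //.
    by move=> x _; rewrite lee_fin sqr_ge0.
  by rewrite -e2; apply/L2norm_leP => //; exact: ltW.
Qed.

End LocalMassDecay.

(** The inequality [ln y < y] at [y = s^(c / k)], raised to the power [k]. *)
Lemma powRN_le_ln (R : realType) (c k : R) : 0 < c -> 0 < k -> exists2 K, 0 < K &
  forall s : R, 1 < s -> s `^ (- c) <= K / ln s `^ k.
Proof.
move=> c0 k0; exists ((k / c) `^ k); first by rewrite powR_gt0// divr_gt0.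
move=> s s1; have s0 : 0 < s by lra.
have l0 : 0 < ln s by exact: ln_gt0.
have ck0 : 0 < c / k by rewrite divr_gt0.
rewrite ler_pdivlMr ?powR_gt0//.
have h : ln s <= k / c * s `^ (c / k).
  have := ln_sublinear (powR_gt0 (c / k) s0); rewrite ln_powR => /ltW h.
  have := ler_wpM2l (ltW (divr_gt0 k0 c0)) h.
  by rewrite mulrA (_ : k / c * (c / k) = 1) ?mul1r//; field; rewrite !gt_eqF.
have : ln s `^ k <= (k / c) `^ k * s `^ c.
  have -> : (k / c) `^ k * s `^ c = (k / c * s `^ (c / k)) `^ k.
    have kc0 : 0 <= k / c by rewrite divr_ge0// ltW.
    rewrite [in RHS]powRM ?powR_ge0// -powRrM; congr (_ * powR _ _).
    by field; rewrite gt_eqF.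
  have kc0 : 0 <= k / c by rewrite divr_ge0// ltW.
  apply: ge0_ler_powR => //; first exact: ltW.
    by rewrite nnegrE ltW.
  by rewrite nnegrE mulr_ge0 ?powR_ge0.
move=> h2; have sc : 0 < s `^ c by rewrite powR_gt0.
by rewrite powRN mulrC ler_pdivrMr.
Qed.

Theorem theorem1p4 (R : realType) (delta : R) (hdelta : 0 < delta)
    (u0 : R -> R) (hu0 : L2 u0)
    (u : R -> R -> R) (hu : ilw_solution delta u0 u)
    (hcont : continuous_L2 u) (hbdd : bounded_L2 u)
    (b : R) (hb0 : 0 < b) (hb : b < 2 / 3) :
  limf_einf (fun t : R => local_mass u (t `^ b) t) +oo%R = 0%E
  /\
  exists (C : R) (t_ : nat -> R),
    [/\ 0 < C,
        forall m n : nat, (m < n)%N -> t_ m < t_ n,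
        t_ n @[n --> \oo] --> +oo%R,
        forall n : nat, 1 < t_ n &
        forall n : nat,
          (local_mass u (t_ n `^ b) (t_ n)
             <= (C / (ln (t_ n)) `^ ((1 - b) / b))%:E)%E].
Proof.
have [C [c [C0 c0 hC]]] := local_mass_decay hdelta hu0 hu hcont hbdd hb0 hb.
have mass0 r t : (0 <= local_mass u r t)%E.
  by apply: integral_ge0 => x _; rewrite lee_fin sqr_ge0.
split.
  rewrite /limf_einf limf_esupE; apply/eqP; rewrite oppe_eq0 eq_le; apply/andP; split.
    apply: (@le_trans _ _ (ereal_sup ((\- (fun t : R => local_mass u (t `^ b) t))%E @` setT))).
      by apply: ereal_inf_lbound; exists setT => //; exact: filterT.
    by apply: ge_ereal_sup => _ [t _ <-]; rewrite oppe_le0.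
  apply: le_ereal_inf_tmp => _ [A [B [Breal hB]] <-].
  apply/lee_addgt0Pr => e e0.
  (* late enough for [C * T `^ (- c) <= e], and past the bound [B] of the
     neighbourhood of +oo *)
  pose T := Num.max 1 (Num.max (`|B| + 1) ((C / e) `^ c^-1)).
  have T1 : 1 <= T by rewrite le_max lexx.
  have TB : `|B| + 1 <= T by rewrite !le_max lexx orbT.
  have Te : (C / e) `^ c^-1 <= T by rewrite !le_max lexx !orbT.
  have T0 : 0 < T by exact: lt_le_trans T1.
  have CTe : C * T `^ (- c) <= e.
    rewrite powRN ler_pdivrMr ?powR_gt0// mulrC -ler_pdivrMr//.
    have Ce : 0 < C / e by rewrite divr_gt0.
    have -> : C / e = ((C / e) `^ c^-1) `^ c.
      by rewrite -powRrM mulVf ?powRr1 ?(ltW Ce)// gt_eqF.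
    apply: ge0_ler_powR => //; first exact: ltW.
      by rewrite nnegrE powR_ge0.
    by rewrite nnegrE ltW.
  have [s sT hs] := hC T T1.
  have As : A s by apply: hB; have := ler_norm B; lra.
  rewrite -leeBlDr// sub0e.
  apply: (@le_trans _ _ (- local_mass u (s `^ b) s)%E).
    by rewrite leeN2; apply: le_trans hs _; rewrite lee_fin.
  by apply: ereal_sup_ubound; exists s.
have k0 : 0 < (1 - b) / b by rewrite divr_gt0//; lra.
have [K K0 hK] := powRN_le_ln c0 k0.
(* the intervals ]4^n, 2 * 4^n[ in which the times are found succeed one
   another without overlapping, so that the times increase *)
have T1 n : 1 <= 4 ^+ n :> R by apply: exprn_ege1; lra.
have hT n := hC _ (T1 n).
pose t_ n := s2val (cid2 (hT n)).
have tT n : 4 ^+ n < t_ n < 2 * 4 ^+ n := s2valP (cid2 (hT n)).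
have tM n : (local_mass u (t_ n `^ b) (t_ n) <= (C * (4 ^+ n) `^ (- c))%:E)%E :=
  s2valP' (cid2 (hT n)).
exists (C * 2 `^ c * K), t_; split.
- by rewrite !mulr_gt0// powR_gt0.
- move=> m n mn; have := tT m; have := tT n.
  have : 4 ^+ m.+1 <= 4 ^+ n :> R by apply: ler_weXn2l => //; rewrite ler1n.
  by rewrite exprS; have := T1 m; lra.
- apply/cvgryPge => A; have /cvgryPge/(_ A) := @cvgr_idn R.
  apply: filterS => n /le_trans; apply; have := tT n.
  have : (n%:R : R) <= 4 ^+ n.
    by rewrite -natrX ler_nat ltnW// ltn_expl.
  lra.
- by move=> n; have := tT n; have := T1 n; lra.
- move=> n; have t1 : 1 < t_ n by have := tT n; have := T1 n; lra.
  apply: le_trans (tM n) _; rewrite lee_fin -!mulrA; apply: ler_wpM2l; first exact: ltW.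
  apply: (@le_trans _ _ (2 `^ c * t_ n `^ (- c))); last first.
    by apply: ler_wpM2l; [exact: powR_ge0|exact: hK].
  have t0 : 0 < t_ n by lra.
  have p0 : 0 < 4 ^+ n :> R by rewrite exprn_gt0.
  rewrite !powRN ler_pdivlMr ?powR_gt0// mulrC ler_pdivrMr ?powR_gt0//.
  rewrite -powRM ?(ltW p0)//.
  by apply: ge0_ler_powR; rewrite ?nnegrE ?(ltW c0) ?mulr_ge0 ?(ltW t0) ?(ltW p0)//;
    have := tT n; lra.
Qed.
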